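(* Let $f$ be a quasimodular form of weight $k$ and depth $\le p$ on $SL_2(\mathbb Z)$. Then the quasimodular form $\vartheta_{k-p}^{[n]}(f)$ has depth $\le p$ for all integers $n\ge0$.
   Context: $q=e^{2\pi i\tau}$, $D=\frac1{2\pi i}\frac d{d\tau}$, $E_2=1-24\sum\frac{nq^n}{1-q^n}$, $E_4=1+240\sum\frac{n^3q^n}{1-q^n}$, $E_6=1-504\sum\frac{n^5q^n}{1-q^n}$. The quasimodular forms on $SL_2(\mathbb Z)$ form the ring $\mathbb C[E_2,E_4,E_6]$, graded by weight ($E_j$ has weight $j$); the depth of a quasimodular form is its degree as a polynomial in $E_2$. For a real number $a$, $\vartheta_a(g)=Dg-\frac a{12}E_2\,g$, and the canonical higher Serre derivatives with index $a$ are $\vartheta_a^{[0]}(g)=g$, $\vartheta_a^{[1]}(g)=\vartheta_a(g)$, $\vartheta_a^{[n+1]}(g)=\vartheta_{a+2n}\bigl(\vartheta_a^{[n]}(g)\bigr)-\frac{n(n+a-1)}{144}E_4\,\vartheta_a^{[n-1]}(g)$ for $n\ge1$. *)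

(* Defs.v *)
(* The complex numbers are R[i] for an arbitrary R : realType. *)
From HB Require Import structures.
From mathcomp Require Import all_boot all_order all_algebra.
From mathcomp Require Import complex.
(* The notations of mpoly clash with those of MathComp-Analysis. *)
From mathcomp Require Import -(notations) mpoly.
From mathcomp Require Import all_classical all_reals all_analysis.

Set Implicit Arguments.
Unset Strict Implicit.
Unset Printing Implicit Defensive.

Import Order.TTheory GRing.Theory Num.Theory.
Import numFieldNormedType.Exports.
Local Open Scope ring_scope.
Local Open Scope complex_scope.

(* Functions on the upper half-plane are represented by total functions
   R[i] -> R[i] of which only the values on [upper_half_plane] matter; that set
   is open, so complex derivatives at its points depend on these values only. *)
Definition upper_half_plane (R : realType) (t : R[i]) : Prop :=
  0 < complex.Im t.

Definition cexp (R : realType) (z : R[i]) : R[i] :=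
  (expR (complex.Re z) * cos (complex.Im z))
  +i* (expR (complex.Re z) * sin (complex.Im z)).

Definition two_pi_i (R : realType) : R[i] := 0 +i* (2 * pi).

Definition nome (R : realType) (t : R[i]) : R[i] := cexp (two_pi_i R * t).

(* \sum_(n >= 1) n^m q^n / (1 - q^n); the summation index is shifted by one.
   The regular module R[i]^o carries the topology of the modulus, and [limn] is
   the limit of the partial sums. *)
Definition lambert (R : realType) (m : nat) (t : R[i]) : R[i] :=
  limn (series (fun n : nat =>
    (n.+1%:R ^+ m * nome t ^+ n.+1 / (1 - nome t ^+ n.+1) : R[i]^o))).

Definition E2 (R : realType) (t : R[i]) : R[i] := 1 - 24 * lambert 1 t.
Definition E4 (R : realType) (t : R[i]) : R[i] := 1 + 240 * lambert 3 t.
Definition E6 (R : realType) (t : R[i]) : R[i] := 1 - 504 * lambert 5 t.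

(* [derive1] over the field R[i] is the complex derivative. *)
Definition Dtau (R : realType) (g : R[i] -> R[i]) (t : R[i]) : R[i] :=
  (two_pi_i R)^-1 * derive1 (g : R[i] -> R[i]^o) t.

Definition serre (R : realType) (a : R) (g : R[i] -> R[i]) (t : R[i]) : R[i] :=
  Dtau g t - (a / 12)%:C * E2 t * g t.

Fixpoint serre_iter (R : realType) (a : R) (n : nat) (g : R[i] -> R[i])
    {struct n} : R[i] -> R[i] :=
  match n with
  | 0 => g
  | n'.+1 =>
    match n' with
    | 0 => serre a g
    | m.+1 => fun t =>
        serre (a + 2 * n'%:R) (serre_iter a n' g) t
        - (n'%:R * (n'%:R + a - 1) / 144)%:C * E4 t * serre_iter a m g t
    end
  end.

(* The variables 'X_0, 'X_1, 'X_2 of {mpoly R[i][3]} stand for E2, E4, E6. *)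
Definition eisenstein (R : realType) (t : R[i]) (i : 'I_3) : R[i] :=
  tnth [tuple E2 t; E4 t; E6 t] i.

Definition qm_weight (m : multinom 3) : nat :=
  (\sum_(i < 3) tnth [tuple 2; 4; 6] i * m i)%N.

Definition weight_homog (R : realType) (k : nat) (P : mpoly 3 R[i]) : Prop :=
  {in msupp P, forall m : multinom 3, qm_weight m = k}.

Definition E2_degree_le (R : realType) (p : nat) (P : mpoly 3 R[i]) : Prop :=
  {in msupp P, forall m : multinom 3, (m ord0 <= p)%N}.

(* f is a quasimodular form on SL_2(Z) of weight k and depth at most p:
   a polynomial in E2, E4, E6, homogeneous of weight k and of degree at most p
   in E2.  As E2, E4, E6 are algebraically independent, P is determined by f,
   so the existential is harmless.  The zero form has every weight. *)
Definition quasimodular (R : realType) (k p : nat) (f : R[i] -> R[i]) : Prop :=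
  exists P : mpoly 3 R[i],
    [/\ weight_homog k P, E2_degree_le p P
      & forall t, upper_half_plane t -> f t = meval (eisenstein t) P].

(* Main.v *)
(* With x, y, z standing for E2, E4, E6, Ramanujan's identities read
   12 Dx = x^2 - y, 3 Dy = xy - z, 2 Dz = xz - y^2.  Hence for a monomial
   m = x^i y^j z^l of weight k the coefficient of x m in
   Dm - (k - p)/12 x m is (p - i)/12, which vanishes exactly when i = p, and the
   other terms do not raise the degree in x: for every p, the operator
   theta_(k-p) maps weight k and depth <= p to weight k + 2 and depth <= p.  As
   the index grows by 2 with the weight, the recursion preserves depth <= p.

   Ramanujan's identities amount to evaluations of the convolution sums
   sum_(ax + by = n) a^r b^s for (r, s) = (1,1), (1,3), (1,5), (3,3).  These
   follow from Liouville's method: (a, x, b, y) -> (a, x - y, a + b, y) is a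
   bijection from the solutions with y < x to the solutions with a < b. *)
Require Import Defs.
From HB Require Import structures.
From mathcomp Require Import all_boot all_order all_algebra.
From mathcomp Require Import complex.
From mathcomp Require Import -(notations) mpoly.
From mathcomp Require Import all_classical all_reals all_analysis.
From mathcomp Require Import ring lra zify.
Import Order.TTheory GRing.Theory Num.Theory.
Import numFieldNormedType.Exports.
Import Normc.
Local Open Scope ring_scope.
Local Open Scope complex_scope.

Set Implicit Arguments.
Unset Strict Implicit.
Unset Printing Implicit Defensive.

(** * Convolution sums of divisor functions *)

(** Everything is done on q-expansions; no transformation law under SL_2(Z) enters. For an even
    power, Liouville's method compares (a - b)^(2m) with (a + b)^(2m), so it sees exactly the
    products a^r b^s with r, s odd and r + s = 2m. This settles (1,1) and (1,3), but 2m = 6 yields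
    only a combination of (1,5) and (3,3). The sum (3,3) therefore needs its own use of the shift;
    it also expresses the series of sigma_7, which belongs to no generator, through E4^2.

    Derivatives enter through the terms n sigma_k(n) of the convolution sums, since D multiplies the
    n-th coefficient of a q-series by n. The analytic obstacle is to justify, for Lambert series
    given as limits, the rearrangement into power series, the Cauchy product and termwise
    differentiation; all three rest on explicit bounds by polynomial times geometric sequences. *)

Definition pos_pairs (n : nat) : seq (nat * nat) :=
  [seq (a, x) | a <- iota 1 n, x <- iota 1 n].

Definition dpairs (n : nat) : seq (nat * nat) :=
  [seq p <- pos_pairs n | p.1 * p.2 == n]%N.

(* The entry ((a, x), (b, y)) is a solution of a x + b y = n. *)
Definition reps (n : nat) : seq ((nat * nat) * (nat * nat)) :=
  [seq r <- [seq (p, p') | p <- pos_pairs n, p' <- pos_pairs n]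
     | (r.1.1 * r.1.2 + r.2.1 * r.2.2 == n)%N].

Lemma pos_pairs_uniq n : uniq (pos_pairs n).
Proof. by apply: allpairs_uniq;
  rewrite ?iota_uniq // => -[a x] [b y] _ _ /= [-> ->]. Qed.

Lemma mem_pos_pairs n p :
  (p \in pos_pairs n) = [&& 0 < p.1, p.1 <= n, 0 < p.2 & p.2 <= n]%N.
Proof.
apply/allpairsP/idP => [[q [+ + ->]]|H]; last exists p;
rewrite ?mem_iota ?add1n ?ltnS; try by move=> /andP[-> ->] /andP[-> ->].
by case/and4P: H => -> -> -> ->; case: p.
Qed.

Lemma mem_dpairs n p :
  (p \in dpairs n) = [&& 0 < p.1, 0 < p.2 & p.1 * p.2 == n]%N.
Proof.
rewrite mem_filter mem_pos_pairs; case: p => a x /=.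
apply/andP/and3P => [[/eqP e /and4P[-> _ -> _]]|[a0 x0 /eqP <-]]; first by rewrite e.
by rewrite a0 x0 leq_pmulr ?leq_pmull.
Qed.

Lemma dpairs_uniq n : uniq (dpairs n).
Proof. exact/filter_uniq/pos_pairs_uniq. Qed.

Lemma mem_reps n r :
  (r \in reps n) = [&& 0 < r.1.1, 0 < r.1.2, 0 < r.2.1, 0 < r.2.2
                     & r.1.1 * r.1.2 + r.2.1 * r.2.2 == n]%N.
Proof.
rewrite mem_filter.
have -> : (r \in [seq (p, p') | p <- pos_pairs n, p' <- pos_pairs n]) =
    (r.1 \in pos_pairs n) && (r.2 \in pos_pairs n).
  apply/allpairsP/andP => [[q [? ? ->]] //|[H1 H2]].
  by exists r; split => //; case: r {H1 H2}.
rewrite !mem_pos_pairs; case: r => [[a x] [b y]] /=.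
apply/and3P/and5P => [[/eqP e /and4P[-> _ -> _] /and4P[-> _ -> _]]|];
  first by rewrite e.
case=> a0 x0 b0 y0 /eqP <-; split=> //; apply/and4P; split=> //.
- by rewrite (leq_trans (leq_pmulr a x0)) ?leq_addr.
- by rewrite (leq_trans (leq_pmull x a0)) ?leq_addr.
- by rewrite (leq_trans (leq_pmulr b y0)) ?leq_addl.
- by rewrite (leq_trans (leq_pmull y b0)) ?leq_addl.
Qed.

Lemma reps_uniq n : uniq (reps n).
Proof.
apply/filter_uniq/allpairs_uniq; rewrite ?pos_pairs_uniq //.
by move=> [a x] [b y] _ _ /= [-> ->].
Qed.

(** The maps need to be mutually inverse only on the filtered lists: the substitutions used below
    involve truncated subtraction and are invertible only under the order constraint in the
    predicate. *)
Lemma big_seq_bij (V : nmodType) (I J : eqType) (s : seq I) (t : seq J)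
    (f : I -> J) (g : J -> I) (P : pred I) (Q : pred J) (F : I -> V) :
  uniq s -> uniq t ->
  (forall i, i \in s -> P i -> [/\ f i \in t, Q (f i) & g (f i) = i]) ->
  (forall j, j \in t -> Q j -> [/\ g j \in s, P (g j) & f (g j) = j]) ->
  \sum_(i <- s | P i) F i = \sum_(j <- t | Q j) F (g j).
Proof.
move=> us ut fP gP; rewrite -big_filter -[RHS]big_filter -[RHS](big_map g xpredT F).
apply/perm_big/uniq_perm.
- exact: filter_uniq.
- rewrite map_inj_in_uniq ?filter_uniq // => j1 j2.
  rewrite !mem_filter => /andP[Q1 t1] /andP[Q2 t2] /(congr1 f).
  by case: (gP _ t1 Q1) => _ _ ->; case: (gP _ t2 Q2) => _ _ ->.
move=> i; apply/idP/mapP => [|[j + ->]]; rewrite !mem_filter.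
  by case/andP => Pi si; case: (fP i si Pi) => tf Qf gf; exists (f i);
    rewrite // mem_filter Qf.
by case/andP => Qj tj; case: (gP j tj Qj) => -> ->.
Qed.

Section Sums.
Variable K : numFieldType.
Implicit Types (F : nat -> nat -> nat -> nat -> K) (P : nat -> nat -> nat -> nat ->
  bool).

Definition rsum n P F : K :=
  \sum_(r <- reps n | P r.1.1 r.1.2 r.2.1 r.2.2) F r.1.1 r.1.2 r.2.1 r.2.2.

Definition dsum n (G : nat -> nat -> K) : K := \sum_(p <- dpairs n) G p.1 p.2.

Definition sigma (r n : nat) : K := dsum n (fun d _ => d%:R ^+ r).


Lemma eq_rsum n P Q F G :
  (forall a x b y, 0 < a -> 0 < x -> 0 < b -> 0 < y -> a * x + b * y = n ->
     P a x b y = Q a x b y)%N ->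
  (forall a x b y, 0 < a -> 0 < x -> 0 < b -> 0 < y -> a * x + b * y = n ->
     P a x b y -> F a x b y = G a x b y)%N ->
  rsum n P F = rsum n Q G.
Proof.
move=> PQ FG; rewrite /rsum [LHS]big_seq_cond [RHS]big_seq_cond.
apply: eq_big => [[[a x] [b y]]|[[a x] [b y]]] /=; rewrite mem_reps /=.
  case: and5P => //= -[a0 x0 b0 y0 /eqP e]; exact: PQ.
by case/andP=> /and5P[a0 x0 b0 y0 /eqP e] Pr; apply: FG => //; exact: Pr.
Qed.

Lemma rsum_swap n P F :
  rsum n P F = rsum n (fun a x b y => P b y a x) (fun a x b y => F b y a x).
Proof.
apply: (big_seq_bij (f := fun r => (r.2, r.1)) (g := fun r => (r.2, r.1)));
  rewrite ?reps_uniq // => -[[a x] [b y]];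
    rewrite !mem_reps /= => /and5P[-> -> -> -> e] Pr;
  split => //=; by rewrite addnC e.
Qed.

Lemma rsum_flip1 n P F :
  rsum n P F = rsum n (fun a x b y => P x a b y) (fun a x b y => F x a b y).
Proof.
pose f (r : (nat * nat) * (nat * nat)) := ((r.1.2, r.1.1), r.2).
apply: (big_seq_bij (f := f) (g := f));
  rewrite ?reps_uniq // => -[[a x] [b y]];
    rewrite !mem_reps /= => /and5P[-> -> -> -> e] Pr;
  split => //=; by rewrite mulnC e.
Qed.

Lemma rsum_flip2 n P F :
  rsum n P F = rsum n (fun a x b y => P a x y b) (fun a x b y => F a x y b).
Proof. by rewrite rsum_swap rsum_flip1 rsum_swap. Qed.

(** The shift preserves the equation because a x + b y = a (x - y) + (a + b) y; the summand is
    transported by the inverse map, whose subtraction b - a is exact when a < b. *)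
Lemma rsum_shift n F :
  rsum n (fun a x b y => y < x)%N F =
  rsum n (fun a x b y => a < b)%N (fun a x b y => F a (x + y)%N (b - a)%N y).
Proof.
pose f (r : (nat * nat) * (nat * nat)) :=
  ((r.1.1, r.1.2 - r.2.2), (r.1.1 + r.2.1, r.2.2))%N.
pose g (r : (nat * nat) * (nat * nat)) :=
  ((r.1.1, r.1.2 + r.2.2), (r.2.1 - r.1.1, r.2.2))%N.
apply: (big_seq_bij (f := f) (g := g)); rewrite ?reps_uniq // => -[[a x] [b y]];
  rewrite !mem_reps /f /g /= => /and5P[a0 x0 b0 y0 /eqP e] lt; split;
    rewrite ?a0 ?y0 /=.
- have : (a * (x - y) + a * y = a * x)%N by rewrite -mulnDr subnK // ltnW.
  by rewrite mulnDl; lia.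
- lia.
- congr (_, _, (_, _)); lia.
- have : ((b - a) * y + a * y = b * y)%N by rewrite -mulnDl subnK // ltnW.
  by rewrite mulnDr; lia.
- lia.
- congr (_, _, (_, _)); lia.
Qed.

(** If x = y = e, the equation reads (a + b) e = n: thus d = a + b is a divisor and b runs freely
    over 1, ..., d - 1. *)
Lemma rsum_diag n F :
  rsum n (fun a x b y => x == y) F =
  dsum n (fun d e => \sum_(1 <= b < d) F (d - b)%N e b e).
Proof.
pose h (p : nat * nat) (b : nat) := (p, b).
pose t := [seq h p b | p <- dpairs n, b <- index_iota 1 p.1].
pose H (j : nat * nat * nat) := F (j.1.1 - j.2)%N j.1.2 j.2 j.1.2.
have -> : dsum n (fun d e => \sum_(1 <= b < d) F (d - b)%N e b e) = \sum_(j <- t) H j.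
  by rewrite big_allpairs_dep.
pose f (r : (nat * nat) * (nat * nat)) : (nat * nat) * nat := ((r.1.1 + r.2.1,
  r.1.2), r.2.1)%N.
pose g (j : nat * nat * nat) := ((j.1.1 - j.2, j.1.2), (j.2, j.1.2))%N.
have mt j : (j \in t) = [&& j.1 \in dpairs n, 0 < j.2 & j.2 < j.1.1]%N.
  case: j => p b /=; apply/allpairsPdep/andP => [[p' [b' [m1 + [-> ->]]]]|[m1 m2]].
    by rewrite mem_index_iota m1.
  by exists p, b; rewrite mem_index_iota.
apply: (big_seq_bij (f := f) (g := g) (P := fun r => r.1.2 == r.2.2)
  (Q := xpredT) (fun r => F r.1.1 r.1.2 r.2.1 r.2.2)); rewrite ?reps_uniq //.
- apply: allpairs_uniq_dep; rewrite ?dpairs_uniq //; first by move=> p _;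
  exact: iota_uniq.
  by move=> [p b] [p' b'] _ _ [-> ->].
- move=> [[a x] [b y]]; rewrite mem_reps mt mem_dpairs /=.
  move=> /and5P[a0 x0 b0 y0 e] /eqP xy; subst y.
  have ba : (b < a + b)%N by lia.
  by rewrite mulnDl e x0 b0 addn_gt0 a0 ba /g /= addnK.
- move=> [[d e] b]; rewrite mem_reps mt mem_dpairs /= => /and3P[/and3P[d0 e0 de] b0
  lt] _.
  by rewrite subn_gt0 lt e0 b0 -mulnDl subnK ?(ltnW lt) // de /f /= subnK ?(ltnW lt).
Qed.

(** * Liouville's identity *)

Definition rtot n F := rsum n (fun _ _ _ _ => true) F.

Lemma rsum_cmp n (u v : nat -> nat -> nat -> nat -> nat) F :
  rtot n F = rsum n (fun a x b y => u a x b y < v a x b y)%N F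
           + rsum n (fun a x b y => u a x b y == v a x b y)%N F
           + rsum n (fun a x b y => v a x b y < u a x b y)%N F.
Proof.
rewrite /rtot /rsum (bigID (fun r => v r.1.1 r.1.2 r.2.1 r.2.2 < u r.1.1 r.1.2
  r.2.1 r.2.2)%N) /= addrC.
congr (_ + _); rewrite (bigID (fun r => v r.1.1 r.1.2 r.2.1 r.2.2 == u r.1.1 r.1.2
  r.2.1 r.2.2)%N) /= addrC.
by congr (_ + _); apply: eq_bigl => r; case: ltngtP.
Qed.

Lemma dsum_swap n G : dsum n G = dsum n (fun d e => G e d).
Proof.
pose f (p : nat * nat) := (p.2, p.1).
apply: (big_seq_bij (f := f) (g := f) (P := xpredT) (Q := xpredT)
  (fun p => G p.1 p.2)); rewrite ?dpairs_uniq // => -[d e];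
  by rewrite !mem_dpairs /= => /and3P[-> -> E] _; rewrite mulnC E.
Qed.

Lemma dsumD n G H : dsum n (fun d e => G d e + H d e) = dsum n G + dsum n H.
Proof. exact: big_split. Qed.

Lemma dsumB n G H : dsum n (fun d e => G d e - H d e) = dsum n G - dsum n H.
Proof. exact: sumrB. Qed.

Lemma eq_dsum n G H :
  (forall d e, 0 < d -> 0 < e -> d * e = n -> G d e = H d e)%N ->
  dsum n G = dsum n H.
Proof.
move=> E; rewrite /dsum big_seq [RHS]big_seq; apply: eq_bigr => -[d e].
by rewrite mem_dpairs => /and3P[d0 e0 /eqP]; apply: E.
Qed.

(** With truncated subtraction, a - b + (b - a) is |a - b|. The terms with a = b vanish by F 0 = 0,
    the cases a < b and b < a agree by symmetry, and the shift read backwards turns b - a into b. *)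
Lemma rsum_sub n (F : nat -> K) : F 0%N = 0 ->
  rtot n (fun a x b y => F (a - b + (b - a))%N) =
  2 * rsum n (fun a x b y => y < x)%N (fun a x b y => F b).
Proof.
move=> F0; rewrite (rsum_cmp _ (fun a x b y => a) (fun a x b y => b)).
rewrite [X in _ + X + _](_ : _ = 0) ?addr0; last first.
  by apply: big1 => r /eqP ->; rewrite subnn.
rewrite [X in _ + X]rsum_swap rsum_shift mulrDl !mul1r.
by congr (_ + _); apply: eq_rsum => // a x b y _ _ _ _ _ lt; congr F; lia.
Qed.

(** The shift makes a + b the new b, so each of the cases y < x and x < y gives the sum over a < b.
    The case x = y contributes F d once for each of the d - 1 splittings d = a + b. *)
Lemma rsum_add n (F : nat -> K) :
  rtot n (fun a x b y => F (a + b)%N) =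
  2 * rsum n (fun a x b y => a < b)%N (fun a x b y => F b)
  + dsum n (fun d e => (d%:R - 1) * F d).
Proof.
rewrite (rsum_cmp _ (fun a x b y => x) (fun a x b y => y)).
rewrite [X in X + _ + _]rsum_swap !rsum_shift rsum_diag mulrDl !mul1r.
rewrite addrAC; congr (_ + _ + _).
- by apply: eq_rsum => // a x b y _ _ _ _ _ lt; congr F; lia.
- by apply: eq_rsum => // a x b y _ _ _ _ _ lt; congr F; lia.
apply: eq_dsum => d e d0 e0 _.
rewrite (eq_big_nat _ _ (F2 := fun=> F d)) => [|b /andP[_ /ltnW lt]];
  last by rewrite subnK.
by rewrite big_const_nat iter_addr_0 -[LHS]mulr_natl natrB.
Qed.

(* Both sums are compared with the one over b < x, which the shift composed with
   a <-> x and b <-> y identifies with the sum over x < y. *)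
Lemma rsum_exchange n (F : nat -> K) :
  rsum n (fun a x b y => y < x)%N (fun a x b y => F b)
  - rsum n (fun a x b y => a < b)%N (fun a x b y => F b) =
  dsum n (fun d e => (e%:R - 1) * F d - \sum_(1 <= b < d) F b).
Proof.
pose G (a x b y : nat) := F b.
have E1 : rtot n G = rsum n (fun a x b y => b < x)%N G
    + dsum n (fun d e => \sum_(1 <= b < d) F b)
    + rsum n (fun a x b y => y < x)%N G.
  rewrite (rsum_cmp _ (fun a x b y => x) (fun a x b y => y)).
  congr (_ + _ + _).
    by rewrite [RHS]rsum_flip2 rsum_shift [RHS]rsum_flip2 [RHS]rsum_flip1.
  exact: rsum_diag.
have E2 : rtot n G = rsum n (fun a x b y => b < x)%N G
    + dsum n (fun d e => (e%:R - 1) * F d)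
    + rsum n (fun a x b y => a < b)%N G.
  rewrite (rsum_cmp _ (fun a x b y => b) (fun a x b y => a)).
  congr (_ + _ + _); first exact: rsum_flip1.
  rewrite rsum_flip1 rsum_flip2.
  rewrite (eq_rsum (Q := fun a x b y => x == y) (G := fun a x b y => F y)) //.
  rewrite rsum_diag dsum_swap; apply: eq_dsum => d e d0 e0 _.
  by rewrite big_const_nat iter_addr_0 -[LHS]mulr_natl natrB.
rewrite dsumB; apply/eqP; rewrite subr_eq; apply/eqP.
have := E1; rewrite E2 => /(canRL (addKr _)) ->; ring.
Qed.

(** By [rsum_sub] and [rsum_add] the two totals are twice the sums of F b over y < x and over a < b,
    up to a divisor sum. Only the difference of these two sums is needed, and [rsum_exchange]
    evaluates it. *)
Lemma liouville n (F : nat -> K) : F 0%N = 0 ->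
  rtot n (fun a x b y => F (a - b + (b - a))%N)
  - rtot n (fun a x b y => F (a + b)%N) =
  dsum n (fun d e => 2 * ((e%:R - 1) * F d - \sum_(1 <= b < d) F b)
                     - (d%:R - 1) * F d).
Proof.
move=> F0; rewrite dsumB rsum_sub // rsum_add.
rewrite opprD addrA -mulrBr rsum_exchange; congr (_ - _).
exact: mulr_sumr.
Qed.


(** * Evaluation of the convolution sums *)

Definition divisor_conv r s n : K := rtot n (fun a x b y => a%:R ^+ r * b%:R ^+ s).

Lemma divisor_convC r s n : divisor_conv r s n = divisor_conv s r n.
Proof.
by rewrite /divisor_conv /rtot rsum_swap; apply: eq_rsum => // *; rewrite mulrC.
Qed.

Lemma rtotD n F G :
  rtot n (fun a x b y => F a x b y + G a x b y) = rtot n F + rtot n G.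
Proof. exact: big_split. Qed.

Lemma rtotB n F G :
  rtot n (fun a x b y => F a x b y - G a x b y) = rtot n F - rtot n G.
Proof. exact: sumrB. Qed.

Lemma rtotZ n c F : rtot n (fun a x b y => c * F a x b y) = c * rtot n F.
Proof. by rewrite /rtot /rsum mulr_sumr. Qed.

Lemma dsumZ n c G : dsum n (fun d e => c * G d e) = c * dsum n G.
Proof. by rewrite /dsum mulr_sumr. Qed.

Lemma even_powB (a b m : nat) :
  ((a - b + (b - a))%N%:R : K) ^+ (2 * m) = (a%:R - b%:R) ^+ (2 * m).
Proof.
rewrite !exprM; congr (_ ^+ m); case: (leqP a b) => [ab|/ltnW ab].
  by rewrite (eqP ab) add0n natrB // -sqrrN opprB.
by rewrite (eqP ab) addn0 natrB.
Qed.

(** This and the next three are Faulhaber's formulas with denominators cleared. They evaluate the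
    inner sums over b < d left by the diagonal terms. *)
Lemma sum_pow2 d : 6 * \sum_(1 <= b < d) (b%:R : K) ^+ 2 =
  2 * d%:R ^+ 3 - 3 * d%:R ^+ 2 + d%:R.
Proof.
case: d => [|d]; first by rewrite big_geq //; ring.
elim: d => [|d IH]; first by rewrite big_geq //; ring.
rewrite big_nat_recr //= mulrDr IH -[d.+2%:R]natr1 -[d.+1%:R]natr1; ring.
Qed.

Lemma sum_pow4 d : 30 * \sum_(1 <= b < d) (b%:R : K) ^+ 4 =
  6 * d%:R ^+ 5 - 15 * d%:R ^+ 4 + 10 * d%:R ^+ 3 - d%:R.
Proof.
case: d => [|d]; first by rewrite big_geq //; ring.
elim: d => [|d IH]; first by rewrite big_geq //; ring.
rewrite big_nat_recr //= mulrDr IH -[d.+2%:R]natr1 -[d.+1%:R]natr1; ring.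
Qed.

Lemma sum_pow6 d : 42 * \sum_(1 <= b < d) (b%:R : K) ^+ 6 =
  6 * d%:R ^+ 7 - 21 * d%:R ^+ 6 + 21 * d%:R ^+ 5 - 7 * d%:R ^+ 3 + d%:R.
Proof.
case: d => [|d]; first by rewrite big_geq //; ring.
elim: d => [|d IH]; first by rewrite big_geq //; ring.
rewrite big_nat_recr //= mulrDr IH -[d.+2%:R]natr1 -[d.+1%:R]natr1; ring.
Qed.

Lemma sum_pow3 d : 4 * \sum_(1 <= b < d) (b%:R : K) ^+ 3 =
  d%:R ^+ 4 - 2 * d%:R ^+ 3 + d%:R ^+ 2.
Proof.
case: d => [|d]; first by rewrite big_geq //; ring.
elim: d => [|d IH]; first by rewrite big_geq //; ring.
rewrite big_nat_recr //= mulrDr IH -[d.+2%:R]natr1 -[d.+1%:R]natr1; ring.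
Qed.

Lemma liouville_pow m n :
  rtot n (fun a x b y => (a%:R - b%:R) ^+ (2 * m.+1) - (a%:R + b%:R) ^+ (2 * m.+1)) =
  dsum n (fun d e => (2 * e%:R - d%:R - 1) * d%:R ^+ (2 * m.+1)
      - 2 * \sum_(1 <= b < d) b%:R ^+ (2 * m.+1)).
Proof.
have := @liouville n (fun z => z%:R ^+ (2 * m.+1)) (expr0n _ _).
rewrite -[LHS]sumrB => L; transitivity (dsum n (fun d e : nat => 2 *
      ((e%:R - 1) * d%:R ^+ (2 * m.+1) - \sum_(1 <= b < d) b%:R ^+ (2 * m.+1)) -
      (d%:R - 1) * d%:R ^+ (2 * m.+1))); last by apply: eq_dsum => d e _ _ _; ring.
rewrite -L; apply: eq_bigr => r _ /=; by rewrite even_powB natrD.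
Qed.

(** Writing n = d e identifies the terms e d^(2m) on the right of Liouville's identity with n
    sigma_(2m-1)(n), the coefficients of a derivative. *)
Lemma sigma_mul n k : n%:R * sigma k n = dsum n (fun d e => e%:R * d%:R ^+ k.+1).
Proof.
by rewrite -dsumZ; apply: eq_dsum => d e _ _ <-; rewrite natrM exprS; ring.
Qed.

Lemma divisor_conv11 n :
  12 * divisor_conv 1 1 n = 5 * sigma 3 n + sigma 1 n - 6 * (n%:R * sigma 1 n).
Proof.
have := liouville_pow 0 n.
rewrite sigma_mul -!dsumZ -dsumD -dsumB => L.
have -> : 12 * divisor_conv 1 1 n = - 3 * rtot n (fun a _ b _ => (a%:R - b%:R) ^+ 2
  - (a%:R + b%:R) ^+ 2).
  by rewrite -!rtotZ; apply: eq_rsum => // a x b y _ _ _ _ _ _; ring.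
rewrite L -dsumZ; apply: eq_dsum => d e _ _ _.
rewrite mulrBr mulrCA (_ : - 3 * (2 * _) = - (6 * \sum_(1 <= b < d) (b%:R : K) ^+
  2)); last by ring.
rewrite sum_pow2; ring.
Qed.

Lemma divisor_conv13 n :
  240 * divisor_conv 1 3 n = 21 * sigma 5 n + 10 * sigma 3 n - sigma 1 n
                     - 30 * (n%:R * sigma 3 n).
Proof.
have := liouville_pow 1 n.
rewrite sigma_mul -!dsumZ -dsumD -!dsumB => L.
have -> : 240 * divisor_conv 1 3 n =
    - 15 * rtot n (fun a _ b _ => (a%:R - b%:R) ^+ 4 - (a%:R + b%:R) ^+ 4).
  rewrite (_ : 240 * _ = 120 * divisor_conv 1 3 n + 120 * divisor_conv 3 1 n);
    last by rewrite [divisor_conv 3 1 n]divisor_convC; ring.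
  by rewrite -!rtotZ -rtotD; apply: eq_rsum => // a x b y _ _ _ _ _ _; ring.
rewrite L -dsumZ; apply: eq_dsum => d e _ _ _.
rewrite (_ : - 15 * _ = - 15 * ((2 * e%:R - d%:R - 1) * d%:R ^+ 4) + 30 * \sum_(1
  <= b < d) (b%:R : K) ^+ 4); last by ring.
rewrite sum_pow4; ring.
Qed.

(** The expansion of (a + b)^6 - (a - b)^6 is 12 a^5 b + 40 a^3 b^3 + 12 a b^5, and the outer two
    terms have the same sum by symmetry; this explains the coefficients 24 and 40. *)
Lemma divisor_conv15_33 n :
  42 * (24 * divisor_conv 1 5 n + 40 * divisor_conv 3 3 n) = 54 * sigma 7 n
    + 42 * sigma 5 n - 14 * sigma 3 n + 2 * sigma 1 n - 84 * (n%:R * sigma 5 n).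
Proof.
have := liouville_pow 2 n.
rewrite sigma_mul -!dsumZ -dsumD -!(dsumD, dsumB) => L.
have -> : 42 * (24 * divisor_conv 1 5 n + 40 * divisor_conv 3 3 n) =
    - 42 * rtot n (fun a _ b _ => (a%:R - b%:R) ^+ 6 - (a%:R + b%:R) ^+ 6).
  rewrite (_ : 24 * _ = 12 * divisor_conv 1 5 n + 12 * divisor_conv 5 1 n);
    last by rewrite [divisor_conv 5 1 n]divisor_convC; ring.
  by rewrite -!rtotZ -!rtotD -rtotZ; apply: eq_rsum => // a x b y _ _ _ _ _ _; ring.
rewrite L -dsumZ; apply: eq_dsum => d e _ _ _.
rewrite (_ : - 42 * _ = - 42 * ((2 * e%:R - d%:R - 1) * d%:R ^+ 6) + 2 * (42 *
  \sum_(1 <= b < d) (b%:R : K) ^+ 6)); last by ring.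
rewrite sum_pow6; ring.
Qed.

(* 4 a^3 b^3 = a^2 b^2 (a + b)^2 - a^2 b^2 (a - b)^2, and the shift turns the
   sum of the first term into that of the second, up to the terms with x = y. *)
Lemma divisor_conv33 n : 120 * divisor_conv 3 3 n = sigma 7 n - sigma 3 n.
Proof.
pose p (a x b y : nat) : K := a%:R ^+ 2 * b%:R ^+ 2 * (a%:R + b%:R) ^+ 2.
pose m (a x b y : nat) : K := a%:R ^+ 2 * b%:R ^+ 2 * (a%:R - b%:R) ^+ 2.
have -> : 120 * divisor_conv 3 3 n = 30 * (rtot n p - rtot n m).
  rewrite -rtotB -!rtotZ; apply: eq_rsum => // a x b y _ _ _ _ _ _.
  rewrite /p /m; ring.
have -> : rtot n p - rtot n m = dsum n (fun d e => \sum_(1 <= b < d) p (d - b)%N e b e).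
  rewrite (rsum_cmp _ (fun a x b y => x) (fun a x b y => y)).
  rewrite (rsum_cmp _ (fun a x b y => a) (fun a x b y => b) m).
  rewrite -rsum_diag [X in X + _ + _ - _]rsum_swap !rsum_shift.
  rewrite [X in _ - (_ + _ + X)]rsum_swap.
  rewrite [X in _ - (_ + X + _)](_ : _ = 0); last first.
    by apply: big1 => r /eqP E; rewrite /m E subrr expr0n mulr0.
  set A := rsum _ _ _; set B := rsum _ _ _; set C := rsum _ _ _; set D := rsum _ _ _;
    set E := rsum _ _ _.
  have -> : A = D by apply: eq_rsum => // a x b y _ _ _ _ _ lt;
    rewrite /p /m natrB 1?ltnW //; ring.
  have -> : C = E by apply: eq_rsum => // a x b y _ _ _ _ _ lt;
    rewrite /p /m natrB 1?ltnW //; ring.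
  ring.
rewrite -dsumZ -dsumB; apply: eq_dsum => d e _ _ _.
(* On the diagonal a + b = d, so [p] is d^2 b^2 (d - b)^2, a combination of the second, third and
   fourth powers of b. *)
rewrite (eq_big_nat _ _ (F2 := fun b => d%:R ^+ 4 * b%:R ^+ 2 - 2 * d%:R ^+ 3 *
  b%:R ^+ 3 + d%:R ^+ 2 * b%:R ^+ 4)); last first.
  by move=> b /andP[_ /ltnW lt]; rewrite /p natrB //; ring.
rewrite big_split sumrB /= -!mulr_sumr.
have := sum_pow2 d; have := sum_pow3 d; have := sum_pow4 d.
set s2 := \sum_(1 <= b < d) b%:R ^+ 2; set s3 := \sum_(1 <= b < d) b%:R ^+ 3.
set s4 := \sum_(1 <= b < d) b%:R ^+ 4.
move=> e4 e3 e2.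
transitivity (5 * d%:R ^+ 4 * (6 * s2) - 15 * d%:R ^+ 3 * (4 * s3) + d%:R ^+ 2 *
  (30 * s4)); first by ring.
rewrite e4 e3 e2; ring.
Qed.

(** The solutions are sorted by the value i = a x. Since [dpairs 0] is empty, sigma vanishes at 0,
    so the end terms i = 0 and i = n are harmless and the sum has the exact shape of a Cauchy
    product. *)
Lemma divisor_conv_cauchy r s n :
  divisor_conv r s n = \sum_(0 <= i < n.+1) sigma r i * sigma s (n - i).
Proof.
rewrite big_mkord /divisor_conv /rtot /rsum.
rewrite (partition_big (fun q => inord (q.1.1 * q.1.2)%N : 'I_n.+1) xpredT) //=.
apply: eq_bigr => i _; rewrite /sigma /dsum mulr_suml.
under [RHS]eq_bigr do rewrite mulr_sumr.
pose t := [seq (p, p') | p <- dpairs i, p' <- dpairs (n - i)].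
transitivity (\sum_(q <- t) (q.1.1%:R ^+ r * q.2.1%:R ^+ s : K)); last first.
  by rewrite big_allpairs.
have in_le := ltn_ord i.
apply: (big_seq_bij (f := id) (g := id) (Q := xpredT)
  (fun q => q.1.1%:R ^+ r * q.2.1%:R ^+ s)); rewrite ?reps_uniq //.
- apply: allpairs_uniq; rewrite ?dpairs_uniq // => -[p p'] [q q'] _ _ /= [-> ->] //.
- move=> [[a x] [b y]]; rewrite mem_reps /= => /and5P[a0 x0 b0 y0 /eqP e] /eqP E.
  have {}E : (a * x)%N = i by rewrite -E inordK // ltnS -e leq_addr.
  split=> //; apply/allpairsP; exists ((a, x), (b, y)).
  rewrite !mem_dpairs /= a0 x0 b0 y0 E eqxx; split=> //.
  by rewrite -E -e addKn eqxx.
- move=> q /allpairsP[[[a x] [b y]] [+ + ->]] _; rewrite !mem_dpairs mem_reps /=.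
  move=> /and3P[-> -> /eqP ->] /and3P[-> -> /eqP ->].
  by rewrite subnKC // eqxx inord_val eqxx.
Qed.

(** The index list no longer depends on k. This permits exchanging the sum over k <= n with the sum
    over pairs, and bounding sigma by the size of the box. *)
Lemma sigma_pos_pairs m k n : (k <= n)%N ->
  sigma m k = \sum_(p <- pos_pairs n | (p.1 * p.2 == k)%N) p.1%:R ^+ m.
Proof.
move=> kn; rewrite /sigma /dsum.
apply: (big_seq_bij (f := id) (g := id) (P := xpredT)
  (fun p => p.1%:R ^+ m)); rewrite ?dpairs_uniq ?pos_pairs_uniq // => -[a x];
  rewrite mem_dpairs mem_pos_pairs /=.
- move=> /and3P[a0 x0 /eqP E] _; rewrite a0 x0 E eqxx; split=> //.
  by rewrite !(leq_trans _ kn) // -E ?leq_pmulr ?leq_pmull.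
- by move=> /and4P[-> _ -> _] ->.
Qed.
End Sums.

(** * Limits of complex sequences *)

Local Open Scope classical_set_scope.

Section ComplexTopology.
Variable R : realType.
Implicit Types (z w : R[i]) (e : R).

(** The norm of [R[i]] takes values in [R[i]]; the estimates below are made with the real-valued
    [normc] instead. *)
Lemma normr_normc z : `|z| = (normc z)%:C.
Proof. by []. Qed.

Lemma normc_ge0 z : 0 <= normc z.
Proof. by case: z => a b; exact: sqrtr_ge0. Qed.

Lemma normcX z n : normc (z ^+ n) = normc z ^+ n.
Proof. by apply: complexI; rewrite rmorphXn -!normr_normc normrX. Qed.

Lemma normc_nat n : normc (n%:R : R[i]) = n%:R.
Proof. by apply: complexI; rewrite rmorph_nat -normr_normc normr_nat. Qed.

Lemma normc_distC z w : normc (z - w) = normc (w - z).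
Proof. by rewrite -normcN opprB. Qed.

Lemma normc_sum (I : Type) (s : seq I) (P : pred I) (F : I -> R[i]) :
  normc (\sum_(i <- s | P i) F i) <= \sum_(i <- s | P i) normc (F i).
Proof.
elim/big_rec2: _ => [|i x y _ le]; first by rewrite normc0.
by rewrite (le_trans (le_normcD _ _)) // lerD2l.
Qed.

Lemma normc_real (x : R) : normc x%:C = `|x|.
Proof. by rewrite /= expr0n /= addr0 sqrtr_sqr. Qed.

Lemma le_normc_ReIm z : normc z <= `|complex.Re z| + `|complex.Im z|.
Proof.
have -> : normc z = normc ((complex.Re z)%:C + 'i * (complex.Im z)%:C).
  by rewrite -complexE.
rewrite (le_trans (le_normcD _ _)) // normcM !normc_real.
by rewrite /= expr0n expr1n add0r sqrtr1 mul1r.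
Qed.

Lemma normc_ge_ReIm z : `|complex.Re z| <= normc z /\ `|complex.Im z| <= normc z.
Proof.
case: z => a b /=; split; rewrite -sqrtr_sqr ler_wsqrtr //.
  by rewrite lerDl sqr_ge0.
by rewrite lerDr sqr_ge0.
Qed.

(** Positive elements of [R[i]] are real, so complex tolerances in limits reduce to real ones. *)
Lemma gt0_complexE (e : R[i]) : 0 < e -> exists2 d : R, 0 < d & e = d%:C.
Proof.
case: e => a b; rewrite ltcE /= => /andP[/eqP -> a0]; by exists a.
Qed.

Lemma cvg_normcP (T : Type) (F : set_system T) (FF : Filter F) (u : T -> R[i]^o) (l
  : R[i]^o) :
  u @ F --> l <-> forall e, 0 < e -> \forall t \near F, normc (u t - l) < e.
Proof.
split=> [/cvgrPdistC_lt H e e0|H].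
  have := H e%:C; rewrite ltcR => /(_ e0); apply: filterS => t.
  by rewrite normr_normc ltcR.
apply/cvgrPdistC_lt => eps /gt0_complexE[d d0 ->].
by have := H d d0; apply: filterS => t; rewrite normr_normc ltcR.
Qed.

Lemma cvgC_squeeze (u : nat -> R[i]^o) (l : R[i]^o) (v : nat -> R) :
  (forall n, normc (u n - l) <= v n) -> v @ \oo --> 0 -> u @ \oo --> l.
Proof.
move=> uv /cvgrPdistC_lt v0; apply/cvg_normcP => e e0.
have := v0 e e0; apply: filterS => n; rewrite subr0; apply: le_lt_trans.
by rewrite (le_trans (uv n)) // ler_norm.
Qed.

Lemma cvgC_sub (u v : nat -> R[i]^o) (l : R[i]^o) :
  v @ \oo --> l -> (fun n => u n - v n) @ \oo --> (0 : R[i]^o) -> u @ \oo --> l.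
Proof.
move=> /cvg_normcP vl /cvg_normcP uv; apply/cvg_normcP => e e0.
have e2 : 0 < e / 2 by lra.
have := vl _ e2; have := uv _ e2; apply: filterS2 => n; rewrite subr0 => H1 H2.
have -> : u n - l = (u n - v n) + (v n - l) by rewrite addrA subrK.
by rewrite (le_lt_trans (le_normcD _ _)) //; lra.
Qed.

Lemma normc_lim_le (u : nat -> R[i]^o) (l : R[i]^o) (M : R) :
  u @ \oo --> l -> (forall n, normc (u n) <= M) -> normc l <= M.
Proof.
move=> /cvg_normcP ul uM; apply/ler_addgt0Pr => e e0.
have [n _ /(_ n (leqnn n)) un] := ul e e0.
have -> : l = u n + (l - u n) by rewrite addrC subrK.
by rewrite (le_trans (le_normcD _ _)) // lerD // normc_distC ltW.
Qed.

Lemma cvgC_ReIm (u : nat -> R[i]) (x y : R) :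
  (fun n => complex.Re (u n)) @ \oo --> x -> (fun n => complex.Im (u n)) @ \oo --> y ->
  (u : nat -> R[i]^o) @ \oo --> (x +i* y : R[i]^o).
Proof.
move=> /cvgrPdistC_lt ux /cvgrPdistC_lt uy; apply/cvg_normcP => e e0.
have e2 : 0 < e / 2 by lra.
have := ux _ e2; have := uy _ e2; apply: filterS2 => n H1 H2.
rewrite (le_lt_trans (le_normc_ReIm _)) //.
case: (u n) H1 H2 => a b /=; lra.
Qed.

Lemma Re_sum (I : Type) (s : seq I) (P : pred I) (F : I -> R[i]) :
  complex.Re (\sum_(i <- s | P i) F i) = \sum_(i <- s | P i) complex.Re (F i).
Proof. by elim/big_rec2: _ => // i x y _ <-; case: y => ? ?; case: (F i). Qed.

Lemma Im_sum (I : Type) (s : seq I) (P : pred I) (F : I -> R[i]) :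
  complex.Im (\sum_(i <- s | P i) F i) = \sum_(i <- s | P i) complex.Im (F i).
Proof. by elim/big_rec2: _ => // i x y _ <-; case: y => ? ?; case: (F i). Qed.

(** Real and imaginary parts are dominated by the same geometric series, so both converge absolutely
    in R. *)
Lemma is_cvg_series_geometric_bound (c : nat -> R[i]) (M s : R) : 0 <= s < 1 ->
  (forall n, normc (c n) <= M * s ^+ n) -> cvgn (series (c : nat -> R[i]^o)).
Proof.
move=> /andP[s0 s1] cM.
have gc : cvgn (series (geometric M s)) by apply: is_cvg_geometric_series;
  rewrite ger0_norm.
have M0 : 0 <= M by have := cM 0%N; rewrite expr0 mulr1; apply: le_trans;
  exact: normc_ge0.
have rc (d : nat -> R) : (forall n, `|d n| <= normc (c n)) -> cvgn (series d).
  move=> dc; apply: normed_cvg; apply: series_le_cvg gc => n //=.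
    by rewrite mulr_ge0 // exprn_ge0.
  exact: le_trans (dc n) (cM n).
have /cvg_ex[x Rx] := rc (fun n => complex.Re (c n)) (fun n => (normc_ge_ReIm (c n)).1).
have /cvg_ex[y Ry] := rc (fun n => complex.Im (c n)) (fun n => (normc_ge_ReIm (c n)).2).
apply/cvg_ex; exists (x +i* y); apply: (@cvgC_ReIm (series c)).
  by under eq_fun do rewrite /series /= Re_sum.
by under eq_fun do rewrite /series /= Im_sum.
Qed.

Lemma series_normc_bound (c : nat -> R[i]) (M s : R) n : 0 <= s < 1 -> 0 <= M ->
  (forall n, normc (c n) <= M * s ^+ n) ->
  normc (series c n) <= M / (1 - s).
Proof.
move=> /andP[s0 s1] M0 cM; rewrite /series /= (le_trans (normc_sum _ _ _)) //.
have : \sum_(0 <= k < n) normc (c k) <= \sum_(0 <= k < n) M * s ^+ k by exact: ler_sum.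
move=> /le_trans; apply; rewrite -mulr_sumr ler_wpM2l //.
have s10 : 0 < 1 - s by lra.
rewrite big_mkord -(ler_pM2l s10) mulfV ?gt_eqF //.
have := subrX1 s n; have := exprn_ge0 n s0 => ? E.
by rewrite -[1 - s]opprB mulNr -E; lra.
Qed.
End ComplexTopology.

(** * Power series in the unit disc *)

Section PowerSeries.
Variable R : realType.
Implicit Types (a b : nat -> R[i]) (q : R[i]).

(** Each of the n terms of 1 + s + ... + s^(n-1) is at least s^n, and the sum is at most 1/(1 -
    s). *)
Lemma natmul_geometric_bound (s : R) n : 0 <= s < 1 -> n%:R * s ^+ n <= (1 - s)^-1.
Proof.
move=> /andP[s0 s1]; have s10 : 0 < 1 - s by lra.
rewrite -(ler_pM2l s10) mulfV ?gt_eqF //.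
have E := subrX1 s n; have sn := exprn_ge0 n s0.
have : n%:R * s ^+ n <= \sum_(i < n) s ^+ i.
  rewrite -[n in n%:R]card_ord -sum1_card natr_sum mulr_suml; apply: ler_sum => i _.
  by rewrite mul1r ler_wiXn2l // ?(ltW s1) // ltnW.
move=> /(ler_wpM2l (ltW s10)) /le_trans; apply.
by rewrite -[1 - s]opprB mulNr -E; lra.
Qed.

(** With s the square root of r, r^n = s^n s^n and still s < 1: one factor absorbs the growth of a
    coefficient, the other keeps a geometric decay. This splitting is used throughout. *)
Lemma sqrt_lt1 (r : R) : 0 <= r < 1 -> 0 <= Num.sqrt r < 1.
Proof.
by move=> /andP[r0 r1]; rewrite sqrtr_ge0 -sqrtr1 ltr_sqrt.
Qed.

Lemma pow_geometric_bound m (r : R) : 0 <= r < 1 ->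
  exists M, forall n, n%:R ^+ m * r ^+ n <= M.
Proof.
elim: m r => [|m IH] r r01.
  by exists 1 => n; case/andP: r01 => r0 r1; rewrite mul1r exprn_ile1 // ltW.
have s01 := sqrt_lt1 r01; have [M MP] := IH _ s01.
exists ((1 - Num.sqrt r)^-1 * M) => n.
have /andP[r0 _] := r01; have /andP[s0 s1] := s01.
rewrite -{1}(sqr_sqrtr r0) -exprM mulnC exprM expr2.
by rewrite exprS mulrACA ler_pM ?natmul_geometric_bound // mulr_ge0 ?exprn_ge0 ?ler0n.
Qed.

(* The power series with coefficients a has radius of convergence at least 1. *)
Definition tempered a := forall r : R, 0 <= r < 1 ->
  exists M, forall n, normc (a n) * r ^+ n <= M.

Lemma tempered_bound a q : tempered a -> normc q < 1 ->
  exists2 M : R, 0 <= M & forall n, normc (a n * q ^+ n) <= M * Num.sqrt (normc q) ^+ n.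
Proof.
move=> ta q1; have r01 : 0 <= normc q < 1 by rewrite normc_ge0.
have s01 := sqrt_lt1 r01; have [M MP] := ta _ s01.
have /andP[r0 _] := r01; have /andP[s0 s1] := s01.
exists M.
  by have := MP 0%N; rewrite expr0 mulr1; apply: le_trans; exact: normc_ge0.
move=> n; rewrite normcM normcX -{1}(sqr_sqrtr r0) -exprM mulnC exprM expr2 mulrA.
by rewrite ler_wpM2r ?exprn_ge0.
Qed.

Lemma tempered_natmul a : tempered a -> tempered (fun n => n%:R * a n).
Proof.
move=> ta r r01; have s01 := sqrt_lt1 r01; have [M MP] := ta _ s01.
have /andP[r0 _] := r01; have /andP[s0 s1] := s01.
exists ((1 - Num.sqrt r)^-1 * M) => n; rewrite normcM normc_nat.
rewrite -{1}(sqr_sqrtr r0) -exprM mulnC exprM expr2 mulrACA ler_pM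
  ?natmul_geometric_bound //.
by rewrite mulr_ge0 ?exprn_ge0 ?normc_ge0.
Qed.

(** A crude bound suffices: the box has n^2 pairs, each contributing at most n^m, whence the
    exponent m + 2. *)
Lemma tempered_sigma m : tempered (sigma R[i] m).
Proof.
move=> r r01; have [M MP] := pow_geometric_bound m.+2 r01; exists M => n.
have /andP[r0 _] := r01.
apply: le_trans (MP n); rewrite ler_wpM2r ?exprn_ge0 //.
rewrite (sigma_pos_pairs _ m (leqnn n)) (le_trans (normc_sum _ _ _)) //.
apply: (@le_trans _ _ (\sum_(p <- pos_pairs n) n%:R ^+ m)).
  rewrite big_mkcond big_seq [leRHS]big_seq; apply: ler_sum => p.
  rewrite mem_pos_pairs => /and4P[p0 pn _ _].
  case: ifP => _; last by rewrite exprn_ge0.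
  by rewrite normcX normc_nat lerXn2r ?nnegrE // ler_nat.
rewrite big_const_seq count_predT iter_addr_0 size_allpairs size_iota.
by rewrite -[leLHS]mulr_natl natrM !exprS mulrA.
Qed.

Definition qseries a q : R[i] := limn (series (fun n => a n * q ^+ n : R[i]^o)).

Lemma qseries_cvg a q : tempered a -> normc q < 1 ->
  series (fun n => a n * q ^+ n : R[i]^o) @ \oo --> (qseries a q : R[i]^o).
Proof.
move=> ta q1; have [M M0 MP] := tempered_bound ta q1.
have s01 : 0 <= Num.sqrt (normc q) < 1 by rewrite sqrt_lt1 // normc_ge0.
exact: is_cvg_series_geometric_bound s01 MP.
Qed.

Lemma cvgC_lim (u : nat -> R[i]^o) (l : R[i]^o) : u @ \oo --> l -> limn u = l.
Proof. exact: cvg_lim. Qed.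

Lemma cvgC_mul (u v : nat -> R[i]^o) (l m : R[i]^o) :
  u @ \oo --> l -> v @ \oo --> m -> (fun n => u n * v n : R[i]^o) @ \oo --> (l * m
    : R[i]^o).
Proof. move=> ul vm. exact: (cvgM ul vm). Qed.

Lemma cvgC_add (u v : nat -> R[i]^o) (l m : R[i]^o) :
  u @ \oo --> l -> v @ \oo --> m -> (fun n => u n + v n : R[i]^o) @ \oo --> (l + m
    : R[i]^o).
Proof. move=> ul vm. exact: (cvgD ul vm). Qed.

Lemma qseries_linear a b (c : R[i]) q : tempered a -> tempered b -> normc q < 1 ->
  qseries (fun n => c * a n + b n) q = c * qseries a q + qseries b q.
Proof.
move=> ta tb q1; apply: cvgC_lim.
rewrite (_ : series _ = fun n => c * series (fun k => a k * q ^+ k) n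
                               + series (fun k => b k * q ^+ k) n).
  exact: cvgC_add (cvgC_mul (cvg_cst (c : R[i]^o)) (qseries_cvg ta q1))
    (qseries_cvg tb q1).
apply/funext => n; rewrite /series /= mulr_sumr -big_split.
by apply: eq_bigr => i _ /=; rewrite mulrDl mulrA.
Qed.

Lemma cvgC_pow_geometric (u : nat -> R[i]^o) m (K s : R) : 0 <= K -> 0 <= s < 1 ->
  (forall n, normc (u n) <= K * (n%:R ^+ m * s ^+ n)) -> u @ \oo --> (0 : R[i]^o).
Proof.
move=> K0 s01 uK; have t01 := sqrt_lt1 s01; have [M MP] := pow_geometric_bound m t01.
have /andP[s0 _] := s01; have /andP[t0 t1] := t01.
apply: (@cvgC_squeeze _ _ _ (geometric (K * M) (Num.sqrt s))) => [n|]; last first.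
  by apply: cvg_geometric; rewrite ger0_norm.
rewrite subr0 (le_trans (uK n)) //= -mulrA ler_wpM2l //.
by rewrite -{1}(sqr_sqrtr s0) -exprM mulnC exprM expr2 mulrA ler_wpM2r ?exprn_ge0.
Qed.

Lemma sum_triangle (f : nat -> nat -> R[i]) N :
  \sum_(0 <= n < N) \sum_(0 <= i < n.+1) f i (n - i)%N =
  \sum_(0 <= i < N) \sum_(0 <= j < N - i) f i j.
Proof.
elim: N => [|N IH]; first by rewrite !big_geq.
rewrite big_nat_recr //= IH [RHS]big_nat_recr //= subSnn big_nat1.
rewrite [X in _ + X]big_nat_recr //= subnn addrA -big_split /=; congr (_ + _).
by apply: eq_big_nat => i /andP[_ iN]; rewrite subSn 1?ltnW // big_nat_recr.
Qed.

(** The product of the N-th partial sums runs over a square, the N-th partial sum of the Cauchy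
    product over the triangle i + j < N. The difference has at most N^2 terms, each bounded by A B
    s^N because i + j >= N. *)
Lemma qseries_mul a b q : tempered a -> tempered b -> normc q < 1 ->
  qseries (fun n => \sum_(0 <= i < n.+1) a i * b (n - i)%N) q = qseries a q *
    qseries b q.
Proof.
move=> ta tb q1; apply: cvgC_lim.
apply: (cvgC_sub (cvgC_mul (qseries_cvg ta q1) (qseries_cvg tb q1))).
have [A A0 AP] := tempered_bound ta q1; have [B B0 BP] := tempered_bound tb q1.
set s := Num.sqrt _ in AP BP; have s01 : 0 <= s < 1 by rewrite sqrt_lt1 // normc_ge0.
have /andP[s0 s1] := s01.
apply: (cvgC_pow_geometric (m := 2) (mulr_ge0 A0 B0) s01) => N.
pose f i j := (a i * q ^+ i) * (b j * q ^+ j).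
have -> : series (fun n => (\sum_(0 <= i < n.+1) a i * b (n - i)%N) * q ^+ n) N
          = \sum_(0 <= i < N) \sum_(0 <= j < N - i) f i j.
  rewrite -sum_triangle /series /=; apply: eq_bigr => n _.
  rewrite mulr_suml; apply: eq_big_nat => i /andP[_ iN].
  by rewrite /f mulrACA -exprD subnKC.
rewrite /series /= big_distrlr /= -sumrB (le_trans (normc_sum _ _ _)) //.
apply: (@le_trans _ _ (\sum_(0 <= i < N) N%:R * (A * B * s ^+ N))); last first.
  rewrite big_const_nat subn0 iter_addr_0 -[leLHS]mulr_natl expr2 le_eqVlt.
  by apply/orP; left; apply/eqP; ring.
rewrite big_nat [leRHS]big_nat; apply: ler_sum => i /andP[_ iN].
rewrite [X in _ - X](big_cat_nat (n := (N - i)%N)) ?leq_subr //=.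
rewrite opprD addNKr normcN (le_trans (normc_sum _ _ _)) //.
apply: (@le_trans _ _ (\sum_(N - i <= j < N) A * B * s ^+ N)).
  rewrite big_nat [leRHS]big_nat; apply: ler_sum => j /andP[Nij _].
  rewrite normcM (le_trans (ler_pM (normc_ge0 _) (normc_ge0 _) (AP i) (BP j))) //.
  rewrite mulrACA -exprD ler_wpM2l ?mulr_ge0 // ler_wiXn2l // ?(ltW s1) //.
  by rewrite -leq_subLR.
rewrite big_const_nat iter_addr_0 -[leLHS]mulr_natl ler_wpM2r //.
  by rewrite !mulr_ge0 ?exprn_ge0.
by rewrite ler_nat leq_subr.
Qed.

(** A finite geometric sum, with its end k imposed as a filter: the exchange of sums below produces
    the same range of x for every d, cut off at N / d. *)
Lemma lambert_inner (w : R[i]) k n : (k <= n)%N ->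
  (1 - w) * \sum_(1 <= x < n.+1 | (x <= k)%N) w ^+ x = w - w ^+ k.+1.
Proof.
move=> kn; rewrite (eq_bigl (fun x => true && (x < k.+1)%N)) // -big_nat_widen //.
elim: k {kn} => [|k IH]; first by rewrite big_geq // mulr0 expr1 subrr.
by rewrite big_nat_recr //= mulrDr IH [w ^+ k.+2]exprS; ring.
Qed.

(** Up to q^N the power series collects, for each d <= N, the terms d^m q^(dx) with x <= N / d,
    while the Lambert term is the full geometric series in q^d. The tail starts at the exponent d (N
    / d + 1) > N, so the N tails together are at most N^(m+1) |q|^N / (1 - |q|). *)
Lemma lambert_qseries m q : normc q < 1 ->
  limn (series (fun n : nat =>
    (n.+1%:R ^+ m * q ^+ n.+1 / (1 - q ^+ n.+1) : R[i]^o))) = qseries (sigma R[i] m) q.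
Proof.
move=> q1; apply: cvgC_lim.
have q0 := normc_ge0 q.
have q10 : 0 < 1 - normc q by lra.
have den d : (0 < d)%N -> 1 - normc q <= normc (1 - q ^+ d).
  move=> d0; have := le_normcD (1 - q ^+ d) (q ^+ d).
  rewrite subrK normc1 normcX.
  have : normc q ^+ d <= normc q by rewrite -[leRHS]expr1 ler_wiXn2l // ltW.
  lra.
have := qseries_cvg (@tempered_sigma m) q1.
(* N terms of the Lambert series reach d = N, whereas the power series needs N + 1 terms to reach
   q^N. *)
rewrite -cvg_shiftS => /cvgC_sub; apply.
have s01 : 0 <= normc q < 1 by rewrite q0.
have K0 : 0 <= (1 - normc q)^-1 by rewrite invr_ge0 ltW.
apply: (cvgC_pow_geometric (m := m.+1) K0 s01) => N.
rewrite /series /=.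
have -> : \sum_(0 <= k < N.+1) sigma R[i] m k * q ^+ k =
    \sum_(1 <= d < N.+1) d%:R ^+ m * \sum_(1 <= x < N.+1 | (x <= N %/ d)%N) (q ^+
      d) ^+ x.
  transitivity (\sum_(0 <= k < N.+1) \sum_(p <- pos_pairs N)
      (if (k == p.1 * p.2)%N then p.1%:R ^+ m * q ^+ (p.1 * p.2) else 0 : R[i])).
    apply: eq_big_nat => k /andP[_ kN].
    rewrite (sigma_pos_pairs _ m (n := N)) // mulr_suml big_mkcond.
    by apply: eq_bigr => p _; rewrite eq_sym; case: eqP => // ->.
  rewrite exchange_big /= big_allpairs /index_iota subn1 /= big_seq [RHS]big_seq.
  apply: eq_bigr => d; rewrite mem_iota => /andP[d0 _].
  rewrite mulr_sumr [RHS]big_mkcond; apply: eq_bigr => x _ /=.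
  by rewrite -big_mkcond -[0%N :: iota 1 N]/(index_iota 0 N.+1) big_nat1_eq /= ltnS
    -exprM leq_divRL // [(x * d)%N]mulnC.
rewrite -(big_add1 _ _ 0 N.+1 xpredT (fun d => d%:R ^+ m * q ^+ d / (1 - q ^+ d))) /=.
rewrite -sumrB (le_trans (normc_sum _ _ _)) //.
apply: (@le_trans _ _ (\sum_(1 <= d < N.+1) (1 - normc q)^-1 * (N%:R ^+ m * normc q
  ^+ N))); last first.
  rewrite big_const_nat subn1 /= iter_addr_0 -[leLHS]mulr_natl exprS le_eqVlt.
  by apply/orP; left; apply/eqP; ring.
rewrite big_nat [leRHS]big_nat; apply: ler_sum => d /andP[d0 dN].
have dn0 : 1 - q ^+ d != 0.
  by apply/eqP => E; have := den d d0; rewrite E normc0; lra.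
have -> : d%:R ^+ m * q ^+ d / (1 - q ^+ d) -
    d%:R ^+ m * \sum_(1 <= x < N.+1 | (x <= N %/ d)%N) (q ^+ d) ^+ x =
    (1 - q ^+ d)^-1 * (d%:R ^+ m * (q ^+ d) ^+ (N %/ d).+1).
  apply: (mulfI dn0); rewrite mulrBr [X in _ - X]mulrCA lambert_inner ?leq_div //.
  by field.
rewrite !normcM normcV ler_pM ?mulr_ge0 ?invr_ge0 ?normc_ge0 //.
  by rewrite lef_pV2 ?posrE ?den // (lt_le_trans q10) ?den.
rewrite !normcX normc_nat ler_pM ?exprn_ge0 //.
  by rewrite lerXn2r ?nnegrE // ler_nat.
by rewrite -exprM ler_wiXn2l // ?(ltW q1) // mulnC ltnW // ltn_ceil.
Qed.

End PowerSeries.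

(** * Complex derivatives *)

Lemma is_derive_chain (K : numFieldType) (f g : K^o -> K^o) (x a b : K^o) :
  is_derive x (1 : K^o) g a -> is_derive (g x) (1 : K^o) f b ->
  is_derive x (1 : K^o) (f \o g) (b * a).
Proof.
move=> [dg vg] [df vf].
have Dg := (derivable1_diffP _ _).1 dg; have Df := (derivable1_diffP _ _).1 df.
have Dc := differentiable_comp Dg Df.
split; first exact: (derivable1_diffP _ _).2 Dc.
rewrite -derive1E derive1E'; last exact: Dc.
rewrite (diff_comp Dg Df) (deriv1E df) (deriv1E dg) !derive1E vg vf /=.
by rewrite scale1r mulrC.
Qed.

Section Derivatives.
Variable R : realType.
Implicit Types (a b : nat -> R[i]) (q h : R[i]).

Lemma cvgC_eq (u v : nat -> R[i]^o) (l m : R[i]^o) :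
  u @ \oo --> l -> (forall n, v n = u n) -> m = l -> v @ \oo --> m.
Proof. by move=> ul uv ->; rewrite (_ : v = u) //; apply/funext. Qed.

Lemma normc_gt0 q : q != 0 -> 0 < normc q.
Proof.
by move=> q0; rewrite lt_def normc_ge0 andbT; apply: contra q0 => /eqP/eq0_normc ->.
Qed.

(** The hypothesis is a first-order expansion free of quotients, the form in which the increments of
    power series and of the exponential are estimated. *)
Lemma is_derive_normc (f : R[i] -> R[i]) q (l : R[i]) :
  (forall e : R, 0 < e -> exists2 d : R, 0 < d &
     forall h, normc h < d -> normc (f (q + h) - f q - h * l) <= e * normc h) ->
  is_derive (q : R[i]^o) (1 : R[i]^o) (f : R[i]^o -> R[i]^o) l.
Proof.
move=> H.
have cl : (fun h : R[i]^o => h^-1 *: (((f : R[i]^o -> R[i]^o) \o shift (q :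
  R[i]^o)) (h *: (1 : R[i]^o)) - f q))
    @ 0^' --> (l : R[i]^o).
  apply/cvg_normcP => e e0; have e2 : 0 < e / 2 by lra.
  have [d d0 Hd] := H _ e2.
  have dC : (0 : R[i]) < d%:C by rewrite ltcR.
  apply: filterS2 (dnbhs0_lt (V := R[i]^o) dC) (@nbhs_dnbhs_neq R[i]^o 0) => h.
  rewrite normr_normc ltcR => hd h0.
  have -> : h^-1 *: ((f \o shift q) (h *: 1) - f q) - l = h^-1 * (f (q + h) - f q -
    h * l).
    rewrite [RHS]mulrBr mulKf // /= [h *: 1]mulr1 addrC.
    by rewrite [in RHS]addrC [q + h]addrC.
  rewrite normcM normcV mulrC ltr_pdivrMr.
    by rewrite (le_lt_trans (Hd h hd)) // ltr_pM2r; [lra|exact: normc_gt0].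
  exact: normc_gt0.
split; first by apply/cvg_ex; exists l.
exact: cvg_lim cl.
Qed.

(** Passing from n to n + 1 multiplies the error by q + h and adds h^2 n q^(n-1), so the bound
    survives because n^2 + n <= (n + 1)^2. The derivative is written n q^n / q to match the power
    series with coefficients n a_n. *)
Lemma power_increment q h (r : R) n : q != 0 -> 0 < r -> normc q <= r -> normc (q +
  h) <= r ->
  normc ((q + h) ^+ n - q ^+ n - h * (n%:R * q ^+ n / q)) <=
  normc h ^+ 2 * r ^- 2 * (n%:R ^+ 2 * r ^+ n).
Proof.
move=> q0 r0 qr qhr; elim: n => [|n IH].
  by rewrite !expr0 subrr sub0r mul0r mul0r mulr0 oppr0 normc0 expr0n mul0r mulr0.
have -> : (q + h) ^+ n.+1 - q ^+ n.+1 - h * (n.+1%:R * q ^+ n.+1 / q) =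
    (q + h) * ((q + h) ^+ n - q ^+ n - h * (n%:R * q ^+ n / q))
    + h ^+ 2 * (n%:R * q ^+ n / q).
  by rewrite !exprS -natr1; field.
rewrite (le_trans (le_normcD _ _)) // !normcM.
have nq : normc n%:R * normc (q ^+ n) * normc q^-1 <= n%:R * (r ^- 2 * r ^+ n.+1).
  rewrite normc_nat -mulrA -normcM.
  case: n {IH} => [|n]; first by rewrite !mul0r.
  rewrite exprSr mulfK // normcX ler_wpM2l //.
  have -> : r ^- 2 * r ^+ n.+2 = r ^+ n by rewrite -[n.+2]addn2 exprD mulrC mulfK
    // expf_neq0 // gt_eqF.
  by rewrite lerXn2r ?nnegrE ?normc_ge0 // ltW.
have B := ler_pM (normc_ge0 _) (normc_ge0 _) qhr IH.
have C := ler_wpM2l (sqr_ge0 (normc h)) nq.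
rewrite normcX in C *.
apply: (le_trans (lerD B C)).
rewrite -subr_ge0 -natr1 [r ^+ n.+1]exprSr (_ : _ - _ = normc h ^+ 2 * r ^- 2 * (r
  ^+ n * r) * (n%:R + 1)); last by ring.
by rewrite !mulr_ge0 ?invr_ge0 ?exprn_ge0 ?normc_ge0 ?addr_ge0 // ltW.
Qed.


(** The bound of [power_increment] is summed against a_n with r halfway between |q| and 1; the
    factor n^2 is absorbed since n^2 a_n is still tempered. The error is thus quadratic in h. *)
Lemma qseries_increment a q : tempered a -> q != 0 -> normc q < 1 ->
  exists K d : R, [/\ 0 < K, 0 < d & forall h, normc h < d ->
    normc (qseries a (q + h) - qseries a q - h * (qseries (fun n => n%:R * a n) q / q))
      <= K * normc h ^+ 2].
Proof.
move=> ta q0 q1; have qge0 := normc_ge0 q.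
pose r : R := (1 + normc q) / 2.
have r0 : 0 < r by rewrite /r; lra.
have r1 : r < 1 by rewrite /r; lra.
have rC : normc (r%:C) = r by rewrite normc_real gtr0_norm.
have tn := tempered_natmul ta; have tnn := tempered_natmul tn.
have rlt : normc r%:C < 1 by rewrite rC.
have [M M0 MP] := tempered_bound tnn rlt.
set s := Num.sqrt _ in MP.
have s01 : 0 <= s < 1 by apply: sqrt_lt1; rewrite rC ltW.
have s1 : 0 < 1 - s by case/andP: s01; lra.
have N0 : 0 <= r ^- 2 * M / (1 - s) by rewrite !mulr_ge0 ?invr_ge0 ?exprn_ge0 // ltW.
(* The summand 1 keeps the constant positive even when [M] is 0; the radius r - |q| keeps q + h in
   the disc of radius r. *)
exists (r ^- 2 * M / (1 - s) + 1), (r - normc q); split.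
- by rewrite ltr_wpDl.
- by rewrite /r; lra.
move=> h hd.
have qr : normc q <= r by rewrite /r; lra.
have qhr : normc (q + h) <= r by rewrite (le_trans (le_normcD _ _)) //; lra.
have qh1 : normc (q + h) < 1 by exact: le_lt_trans r1.
apply: (@le_trans _ _ (normc h ^+ 2 * r ^- 2 * M / (1 - s))); last first.
  have := sqr_ge0 (normc h) => h2; rewrite -subr_ge0.
  by rewrite (_ : _ - _ = normc h ^+ 2) //; ring.
pose c n := a n * ((q + h) ^+ n - q ^+ n - h * (n%:R * q ^+ n / q)).
apply: (normc_lim_le (u := series c)); last first.
  move=> n; apply: series_normc_bound => //.
    by rewrite !mulr_ge0 ?invr_ge0 ?exprn_ge0 ?normc_ge0 // ltW.
  move=> k; rewrite /c normcM.
  have P := ler_wpM2l (normc_ge0 (a k)) (power_increment k q0 r0 qr qhr).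
  apply: (le_trans P).
  rewrite mulrCA -[leRHS]mulrA ler_wpM2l ?mulr_ge0 ?sqr_ge0 ?invr_ge0 ?exprn_ge0
    ?(ltW r0) ?normc_ge0 //.
  apply: le_trans _ (MP k); rewrite !normcM normcX !normc_nat rC le_eqVlt.
  by apply/orP; left; apply/eqP; ring.
have C1 := qseries_cvg ta qh1; have C2 := qseries_cvg ta q1;
  have C3 := qseries_cvg tn q1.
apply: (cvgC_eq (cvgC_add C1 (cvgC_mul (cvg_cst (-1 : R[i]^o))
  (cvgC_add C2 (cvgC_mul (cvg_cst (h / q : R[i]^o)) C3))))) => [n|]; last first.
  set x : R[i] := qseries a (q + h); set y : R[i] := qseries a q;
    set z : R[i] := qseries _ q.
  ring.
rewrite /series /= mulr_sumr -big_split mulr_sumr -big_split.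
by apply: eq_bigr => k _ /=; rewrite /c; ring.
Qed.

Lemma qseries_derive a q : tempered a -> q != 0 -> normc q < 1 ->
  is_derive (q : R[i]^o) (1 : R[i]^o) (qseries a : R[i]^o -> R[i]^o)
    (qseries (fun n => n%:R * a n) q / q).
Proof.
move=> ta q0 q1; apply: is_derive_normc => e e0.
have [K [d [K0 d0 H]]] := qseries_increment ta q0 q1.
exists (Num.min d (e / K)); first by rewrite lt_min d0 divr_gt0.
move=> h; rewrite lt_min => /andP[hd he].
apply: le_trans (H h hd) _; rewrite expr2 mulrA ler_wpM2r ?normc_ge0 //.
by rewrite mulrC -ler_pdivlMr // ltW.
Qed.

Lemma derive_epsilon (f : R -> R) (x l : R) : is_derive x (1 : R) f l ->
  forall e : R, 0 < e -> exists2 d : R, 0 < d & forall h : R, `|h| < d ->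
    `|f (x + h) - f x - h * l| <= e * `|h|.
Proof.
move=> [df <-] e e0; have /cvgrPdistC_le H := df.
have /nbhs_ballP[d d0 Hd] := H e e0.
exists d => // h hd; have [->|h0] := eqVneq h 0.
  by rewrite addr0 subrr sub0r mul0r normrN normr0 mulr0.
have : ball (0 : R) d h by rewrite -ball_normE /= sub0r normrN.
move=> /Hd /(_ h0) /=; rewrite [h *: 1]mulr1 [h + x]addrC => Q.
have -> : f (x + h) - f x - h * 'D_1 f x = h * (h^-1 *: (f (x + h) - f x) - 'D_1 f x).
  by rewrite [RHS]mulrBr [h^-1 *: _]/(h^-1 * _) mulVKf.
by rewrite normrM mulrC ler_wpM2r.
Qed.

(** * The complex exponential and the nome *)

Lemma cexpD (z w : R[i]) : cexp (z + w) = cexp z * cexp w.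
Proof.
case: z w => [x y] [x' y']; rewrite /cexp /= expRD cosD sinD; apply/eqP.
by rewrite eq_complex /=; apply/andP; split; apply/eqP; ring.
Qed.

Lemma normc_cexp (z : R[i]) : normc (cexp z) = expR (complex.Re z).
Proof.
rewrite /cexp /= !exprMn -mulrDr cos2Dsin2 mulr1 sqrtr_sqr gtr0_norm //.
exact: expR_gt0.
Qed.

(** Complex differentiability at 0 is derived from the real derivatives of exp, cos and sin at 0;
    the addition law then carries it to every point. *)
Lemma cexp_increment (e : R) : 0 < e -> exists2 d : R, 0 < d &
  forall h, normc h < d -> normc (cexp h - 1 - h) <= e * normc h.
Proof.
(* The real part of the error will cost 3 and the imaginary part 4 times e/8 |h|, in total less than
   e |h|. The bound k <= 1 gives |1 + x| <= 2 and |sin y| <= 2 |y|. *)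
move=> e0; have [k k0 [ke k1]] : exists2 k : R, 0 < k & k <= e / 8 /\ k <= 1.
  exists (Num.min (e / 8) 1); first by rewrite lt_min ltr01 divr_gt0.
  by split; rewrite ge_min lexx ?orbT.
have [d1 d10 H1] := derive_epsilon (is_derive_expR 0) k0.
have [d2 d20 H2] := derive_epsilon (is_derive_cos 0) k0.
have [d3 d30 H3] := derive_epsilon (is_derive_sin 0) k0.
exists (Num.min (Num.min d1 d2) (Num.min d3 k)).
  by rewrite !lt_min d10 d20 d30.
case=> x y; set N := normc _; rewrite !lt_min => /andP[/andP[N1 N2] /andP[N3 Nk]].
have [Nx Ny] : `|x| <= N /\ `|y| <= N := normc_ge_ReIm (x +i* y).
have {H1} := H1 x (le_lt_trans Nx N1).
have {H2} := H2 y (le_lt_trans Ny N2).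
have {H3} := H3 y (le_lt_trans Ny N3).
rewrite !add0r expR0 sin0 cos0 oppr0 mulr0 !mulr1 subr0 addr0 => HS HC HE.
apply: le_trans (le_normc_ReIm _) _ => /=.
rewrite subr0.
have cle : `|cos y| <= 1 by rewrite ler_norml cos_geN1 cos_le1.
have sle : `|sin y| <= 1 by rewrite ler_norml sin_geN1 sin_le1.
have N0 : 0 <= N := normc_ge0 _.
have kxN : k * `|x| <= e / 8 * N by rewrite ler_pM // ltW.
have kyN : k * `|y| <= e / 8 * N by rewrite ler_pM // ltW.
have xk : `|x| <= k by rewrite (le_trans Nx) // ltW.
have syN : `|x| * `|sin y| <= 2 * (e / 8 * N).
  have sy : `|sin y| <= 2 * `|y|.
    have -> : sin y = (sin y - y) + y by rewrite subrK.
    rewrite (le_trans (ler_normD _ _)) //.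
    have := ler_wpM2r (normr_ge0 y) k1; lra.
  apply: le_trans (ler_pM (normr_ge0 _) (normr_ge0 _) xk sy) _.
  by rewrite mulrCA ler_wpM2l.
have E1 : `|expR x * cos y - 1 - x| <= 3 * (e / 8 * N).
  have -> : expR x * cos y - 1 - x = (expR x - 1 - x) * cos y + (1 + x) * (cos y -
    1) by ring.
  rewrite (le_trans (ler_normD _ _)) // !normrM.
  have A1 : `|expR x - 1 - x| * `|cos y| <= k * `|x|.
    by rewrite -[leRHS]mulr1 ler_pM.
  have A2 : `|1 + x| * `|cos y - 1| <= 2 * (k * `|y|).
    rewrite ler_pM // (le_trans (ler_normD _ _)) // normr1.
    lra.
  lra.
have E2 : `|expR x * sin y - y| <= 4 * (e / 8 * N).
  have -> : expR x * sin y - y = (expR x - 1 - x) * sin y + (sin y - y) + x * sin y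
    by ring.
  rewrite (le_trans (ler_normD _ _)) // normrM.
  have A1 : `|(expR x - 1 - x) * sin y| <= k * `|x|.
    by rewrite normrM -[leRHS]mulr1 ler_pM.
  have A2 := ler_normD ((expR x - 1 - x) * sin y) (sin y - y).
  lra.
have := mulr_ge0 (ltW e0) N0; lra.
Qed.

Lemma nomeE (t : R[i]) : normc (nome t) = expR (- (2 * pi * complex.Im t)).
Proof.
rewrite normc_cexp; congr expR; case: t => x y /=; ring.
Qed.

Lemma nome_neq0 (t : R[i]) : nome t != 0.
Proof.
apply/eqP => E; have := nomeE t; rewrite E normc0 => /esym/eqP.
by rewrite gt_eqF // expR_gt0.
Qed.

Lemma nome_lt1 (t : R[i]) : upper_half_plane t -> normc (nome t) < 1.
Proof.
by move=> t0; rewrite nomeE expR_lt1 oppr_lt0 !mulr_gt0 // pi_gt0.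
Qed.

Lemma two_pi_i_neq0 : two_pi_i R != 0.
Proof.
by rewrite eq_complex /= eqxx /= gt_eqF // mulr_gt0 // pi_gt0.
Qed.

Lemma nome_derive (t : R[i]) :
  is_derive (t : R[i]^o) (1 : R[i]^o) (@nome R : R[i]^o -> R[i]^o) (two_pi_i R *
    nome t).
Proof.
apply: is_derive_normc => e e0.
have c0 : 0 < normc (two_pi_i R) := normc_gt0 two_pi_i_neq0.
have q0 : 0 < normc (nome t) := normc_gt0 (nome_neq0 t).
set c := two_pi_i R in c0 *.
have [d d0 Hd] := cexp_increment (divr_gt0 e0 (mulr_gt0 q0 c0)).
exists (d / normc c); first exact: divr_gt0.
move=> h hd.
have chd : normc (c * h) < d by rewrite normcM mulrC -ltr_pdivlMr.
have -> : nome (t + h) - nome t - h * (c * nome t) = nome t * (cexp (c * h) - 1 - c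
  * h).
  by rewrite /nome -/c mulrDr cexpD; ring.
rewrite normcM (le_trans (ler_wpM2l (normc_ge0 _) (Hd _ chd))) //.
rewrite normcM le_eqVlt; apply/orP; left; apply/eqP; field.
by rewrite !gt_eqF.
Qed.

(** The factor q in dq/dt = 2 pi i q cancels the 1/q of the termwise derivative: up to 2 pi i,
    differentiation multiplies the n-th coefficient by n. *)
Lemma qseries_nome_derive a (t : R[i]) : tempered a -> upper_half_plane t ->
  is_derive (t : R[i]^o) (1 : R[i]^o) ((fun t => qseries a (nome t)) : R[i]^o -> R[i]^o)
    (two_pi_i R * qseries (fun n => n%:R * a n) (nome t)).
Proof.
move=> ta t0.
have q0 := nome_neq0 t.
have := is_derive_chain (nome_derive t) (qseries_derive ta q0 (nome_lt1 t0)).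
set z : R[i] := qseries _ _.
by rewrite (_ : z / nome t * _ = two_pi_i R * z) //; field.
Qed.

End Derivatives.

(** * Differentiation rules in one variable *)

Section DeriveRules.
Variables (K : numFieldType) (x : K^o).
Implicit Types (f g : K^o -> K^o) (a b c : K^o).

Lemma is_derive_affine f c a : is_derive x (1 : K^o) f a ->
  is_derive x (1 : K^o) (fun u => 1 - c * f u) (- (c * a)).
Proof.
move=> df; have := is_deriveB (is_derive_cst (1 : K^o) x (1 : K^o)) (is_deriveZ c df).
by rewrite sub0r.
Qed.

Lemma is_derive_mul f g a b : is_derive x (1 : K^o) f a ->
  is_derive x (1 : K^o) g b -> is_derive x (1 : K^o) (fun u => f u * g u) (a * g x
    + f x * b).
Proof.
move=> df dg; apply: is_derive_eq (is_deriveM df dg) _.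
by rewrite addrC [g x *: a]mulrC.
Qed.

Lemma is_derive_pow f a n : is_derive x (1 : K^o) f a ->
  is_derive x (1 : K^o) (fun u => f u ^+ n) (n%:R * f x ^+ n.-1 * a).
Proof.
move=> df; elim: n => [|n IH].
  under eq_fun do rewrite expr0.
  by rewrite !mul0r; exact: is_derive_cst.
under eq_fun do rewrite exprS.
apply: is_derive_eq (is_derive_mul df IH) _.
rewrite -natr1 [n.+1.-1]/=; case: n {IH} => [|n] /=; first by rewrite !expr0; ring.
by rewrite exprS; ring.
Qed.

Lemma is_derive_scale f a c : is_derive x (1 : K^o) f a ->
  is_derive x (1 : K^o) (fun u => c * f u) (c * a).
Proof. exact: is_deriveZ. Qed.

Lemma is_derive_add f g a b : is_derive x (1 : K^o) f a ->
  is_derive x (1 : K^o) g b -> is_derive x (1 : K^o) (fun u => f u + g u) (a + b).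
Proof. exact: is_deriveD. Qed.

Lemma is_derive_bigsum (I : Type) (s : seq I) (F : I -> K^o -> K^o) (G : I -> K^o) :
  (forall i, is_derive x (1 : K^o) (F i) (G i)) ->
  is_derive x (1 : K^o) (fun u => \sum_(i <- s) F i u) (\sum_(i <- s) G i).
Proof.
move=> dF; elim: s => [|i s IH].
  under eq_fun do rewrite big_nil.
  by rewrite big_nil; exact: is_derive_cst.
under eq_fun do rewrite big_cons.
by rewrite big_cons; exact: is_derive_add.
Qed.
End DeriveRules.

(** * Ramanujan's identities *)

Section Eisenstein.
Variable R : realType.
Implicit Types (t : R[i]).

Lemma upper_half_plane_near t : upper_half_plane t ->
  \forall u \near (t : R[i]^o), upper_half_plane (u : R[i]).
Proof.
move=> t0; have t0C : (0 : R[i]) < (complex.Im t)%:C by rewrite ltcR.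
apply/nbhs_ballP; exists (complex.Im t)%:C => // u; rewrite -ball_normE /=.
rewrite normr_normc ltcR => tu.
have := le_lt_trans (normc_ge_ReIm (t - u)).2 tu.
by case: t {t0 t0C tu} => x y; case: u => x' y';
  rewrite /upper_half_plane /= ltr_norml; lra.
Qed.

Lemma lambertE m t : upper_half_plane t -> lambert m t = qseries (sigma R[i] m)
  (nome t).
Proof. by move=> t0; rewrite -lambert_qseries ?nome_lt1. Qed.

(** On the upper half-plane this is D applied to the Lambert series. *)
Definition Dlambert m t : R[i] := qseries (fun n => n%:R * sigma R[i] m n) (nome t).

Lemma lambert_derive m t : upper_half_plane t ->
  is_derive (t : R[i]^o) (1 : R[i]^o) (lambert m : R[i]^o -> R[i]^o)
    (two_pi_i R * Dlambert m t).
Proof.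
move=> t0; apply: near_eq_is_derive (qseries_nome_derive (@tempered_sigma R m) t0).
by apply: filterS (upper_half_plane_near t0) => u u0; rewrite lambertE.
Qed.

Lemma qseriesZ a (c q : R[i]) : tempered a -> normc q < 1 ->
  qseries (fun n => c * a n) q = c * qseries a q.
Proof.
move=> ta q1; have := qseries_linear (c - 1) ta ta q1.
rewrite (_ : (fun n => _) = (fun n => c * a n)) => [->|]; first by ring.
by apply/funext => n; ring.
Qed.

Lemma tempered_linear (a b : nat -> R[i]) c : tempered a -> tempered b ->
  tempered (fun n => c * a n + b n).
Proof.
move=> ta tb r r01; have [M MP] := ta r r01; have [N NP] := tb r r01.
exists (normc c * M + N) => n.
have rn : 0 <= r ^+ n by case/andP: r01 => r0 _; rewrite exprn_ge0.
apply: (le_trans (ler_wpM2r rn (le_normcD _ _))).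
by rewrite normcM mulrDl lerD ?NP // -mulrA ler_wpM2l ?normc_ge0 ?MP.
Qed.

Lemma tempered_scale (a : nat -> R[i]) c : tempered a -> tempered (fun n => c * a n).
Proof.
move=> ta; have := tempered_linear (c - 1) ta ta.
by rewrite (_ : (fun n => _) = (fun n => c * a n)) //; apply/funext => n; ring.
Qed.

Lemma lambert_mul r s t : upper_half_plane t ->
  lambert r t * lambert s t = qseries (divisor_conv R[i] r s) (nome t).
Proof.
move=> t0; rewrite !lambertE // -qseries_mul ?nome_lt1 //; try exact: tempered_sigma.
by congr qseries; apply/funext => n; rewrite divisor_conv_cauchy.
Qed.


Let ts m : tempered (sigma R[i] m) := @tempered_sigma R m.
Let tn m : tempered (fun n => n%:R * sigma R[i] m n) := tempered_natmul (ts m).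

Lemma lambert11 t : upper_half_plane t ->
  12 * (lambert 1 t * lambert 1 t) = 5 * lambert 3 t + lambert 1 t - 6 * Dlambert 1 t.
Proof.
move=> t0; rewrite lambert_mul //.
have -> : divisor_conv R[i] 1 1 = fun n => 5 / 12 * sigma R[i] 3 n +
    (1 / 12 * sigma R[i] 1 n + - (1 / 2) * (n%:R * sigma R[i] 1 n)).
  apply/funext => n; apply: (@mulfI _ 12); first by rewrite pnatr_eq0.
  by rewrite divisor_conv11; field.
have q1 := nome_lt1 t0; have t1 := tempered_scale (- (1 / 2)) (tn 1).
rewrite (qseries_linear _ (ts 3) (tempered_linear _ (ts 1) t1) q1).
rewrite (qseries_linear _ (ts 1) t1 q1) (qseriesZ _ (tn 1) q1).
by rewrite !lambertE // /Dlambert; field.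
Qed.

Lemma lambert13 t : upper_half_plane t ->
  240 * (lambert 1 t * lambert 3 t) =
  21 * lambert 5 t + 10 * lambert 3 t - lambert 1 t - 30 * Dlambert 3 t.
Proof.
move=> t0; rewrite lambert_mul //.
have -> : divisor_conv R[i] 1 3 = fun n => 21 / 240 * sigma R[i] 5 n +
    (1 / 24 * sigma R[i] 3 n + (- (1 / 240) * sigma R[i] 1 n
    + - (1 / 8) * (n%:R * sigma R[i] 3 n))).
  apply/funext => n; apply: (@mulfI _ 240); first by rewrite pnatr_eq0.
  by rewrite divisor_conv13; field.
have q1 := nome_lt1 t0; have t1 := tempered_scale (- (1 / 8)) (tn 3).
have t2 := tempered_linear (- (1 / 240)) (ts 1) t1.
rewrite (qseries_linear _ (ts 5) (tempered_linear _ (ts 3) t2) q1).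
rewrite (qseries_linear _ (ts 3) t2 q1) (qseries_linear _ (ts 1) t1 q1) (qseriesZ _
  (tn 3) q1).
by rewrite !lambertE // /Dlambert; field.
Qed.

(** In terms of Eisenstein series this says E4^2 = 1 + 480 [lambert 7], that is, E4^2 = E8. It
    eliminates [lambert 7] from the derivative of E6. *)
Lemma lambert33 t : upper_half_plane t ->
  120 * (lambert 3 t * lambert 3 t) = lambert 7 t - lambert 3 t.
Proof.
move=> t0; rewrite lambert_mul //.
have -> : divisor_conv R[i] 3 3 = fun n => 1 / 120 * sigma R[i] 7 n +
    - (1 / 120) * sigma R[i] 3 n.
  apply/funext => n; apply: (@mulfI _ 120); first by rewrite pnatr_eq0.
  by rewrite divisor_conv33; field.
have q1 := nome_lt1 t0; have t1 := tempered_scale (- (1 / 120)) (ts 3).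
rewrite (qseries_linear _ (ts 7) t1 q1) (qseriesZ _ (ts 3) q1).
by rewrite !lambertE //; field.
Qed.

Lemma lambert15 t : upper_half_plane t ->
  504 * (lambert 1 t * lambert 5 t) =
  20 * lambert 7 t + 21 * lambert 5 t + lambert 1 t - 42 * Dlambert 5 t.
Proof.
move=> t0; rewrite lambert_mul //.
have -> : divisor_conv R[i] 1 5 = fun n => 20 / 504 * sigma R[i] 7 n +
    (1 / 24 * sigma R[i] 5 n + (1 / 504 * sigma R[i] 1 n
    + - (1 / 12) * (n%:R * sigma R[i] 5 n))).
  apply/funext => n; apply: (@mulfI _ 1008); first by rewrite pnatr_eq0.
  have := divisor_conv15_33 R[i] n; have := divisor_conv33 R[i] n.
  set x := divisor_conv _ _ _ _; set y := divisor_conv _ _ _ _ => Ex Ey.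
  (* Here 1008 = 42 * 24, and 42 * 40 = 14 * 120 lets the evaluation of (3,3) cancel its share of
     the combination. *)
  rewrite (_ : 1008 * y = 42 * (24 * y + 40 * x) - 14 * (120 * x)); last by ring.
  by rewrite Ex Ey; field.
have q1 := nome_lt1 t0; have t1 := tempered_scale (- (1 / 12)) (tn 5).
have t2 := tempered_linear (1 / 504) (ts 1) t1.
rewrite (qseries_linear _ (ts 7) (tempered_linear _ (ts 5) t2) q1).
rewrite (qseries_linear _ (ts 5) t2 q1) (qseries_linear _ (ts 1) t1 q1) (qseriesZ _
  (tn 5) q1).
by rewrite !lambertE // /Dlambert; field.
Qed.

Lemma affine_lambert_derive (c l : R[i]) m t : upper_half_plane t ->
  - c * Dlambert m t = l ->
  is_derive (t : R[i]^o) (1 : R[i]^o) ((fun u => 1 - c * lambert m u) : R[i]^o ->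
    R[i]^o)
    (two_pi_i R * l).
Proof.
move=> t0 <-; have dl := is_derive_affine (c : R[i]^o) (lambert_derive m t0).
by rewrite mulNr mulrN mulrCA.
Qed.

Lemma E2_derive t : upper_half_plane t ->
  is_derive (t : R[i]^o) (1 : R[i]^o) (@E2 R : R[i]^o -> R[i]^o)
    (two_pi_i R * ((E2 t ^+ 2 - E4 t) / 12)).
Proof.
move=> t0; apply: affine_lambert_derive => //.
have E := lambert11 t0; rewrite /E2 /E4.
have -> : Dlambert 1 t = (5 * lambert 3 t + lambert 1 t - 12 * (lambert 1 t *
  lambert 1 t)) / 6.
  by rewrite E; field.
by field.
Qed.

Lemma E4_derive t : upper_half_plane t ->
  is_derive (t : R[i]^o) (1 : R[i]^o) (@E4 R : R[i]^o -> R[i]^o)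
    (two_pi_i R * ((E2 t * E4 t - E6 t) / 3)).
Proof.
move=> t0.
have := @affine_lambert_derive (- 240) ((E2 t * E4 t - E6 t) / 3) 3 t t0.
rewrite opprK (_ : (fun u => _) = @E4 R); last first.
  by apply/funext => u; rewrite mulNr opprK.
apply; have E := lambert13 t0; rewrite /E2 /E4 /E6.
have -> : Dlambert 3 t = (21 * lambert 5 t + 10 * lambert 3 t - lambert 1 t
   - 240 * (lambert 1 t * lambert 3 t)) / 30 by rewrite E; field.
by field.
Qed.

Lemma E6_derive t : upper_half_plane t ->
  is_derive (t : R[i]^o) (1 : R[i]^o) (@E6 R : R[i]^o -> R[i]^o)
    (two_pi_i R * ((E2 t * E6 t - E4 t ^+ 2) / 2)).
Proof.
move=> t0; apply: affine_lambert_derive => //.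
have E := lambert15 t0; have E' := lambert33 t0; rewrite /E2 /E4 /E6.
have -> : Dlambert 5 t = (20 * lambert 7 t + 21 * lambert 5 t + lambert 1 t
   - 504 * (lambert 1 t * lambert 5 t)) / 42 by rewrite E; field.
have -> : lambert 7 t = 120 * (lambert 3 t * lambert 3 t) + lambert 3 t by rewrite
  E' subrK.
by field.
Qed.


Definition eis_monomial (i j l : nat) t : R[i] := E2 t ^+ i * E4 t ^+ j * E6 t ^+ l.

(** Leibniz's rule with Ramanujan's identities; the terms containing E2 times the monomial are
    collected in the first summand. A predecessor of exponent 0 occurs only with coefficient 0. *)
Lemma eis_monomial_derive i j l t : upper_half_plane t ->
  is_derive (t : R[i]^o) (1 : R[i]^o) (eis_monomial i j l : R[i]^o -> R[i]^o)
    (two_pi_i R *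
      ((i%:R / 12 + j%:R / 3 + l%:R / 2) * eis_monomial i.+1 j l t
       - i%:R / 12 * eis_monomial i.-1 j.+1 l t
       - j%:R / 3 * eis_monomial i j.-1 l.+1 t
       - l%:R / 2 * eis_monomial i j.+2 l.-1 t)).
Proof.
move=> t0.
have D := is_derive_mul (is_derive_mul (is_derive_pow i (E2_derive t0))
  (is_derive_pow j (E4_derive t0))) (is_derive_pow l (E6_derive t0)).
apply: is_derive_eq D _.
rewrite /eis_monomial; set c := two_pi_i R; set x := E2 t; set y := E4 t; set z := E6 t.
case: i => [|i]; case: j => [|j]; case: l => [|l];
  rewrite /= ?exprS ?expr0 -?natr1; clearbody c x y z; by field.
Qed.
End Eisenstein.

(** * Depth and the Serre derivative *)

Section Quasimodular.
Variable R : realType.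
Implicit Types (k p : nat) (f g : R[i] -> R[i]).

Lemma quasimodular_ext k p f g :
  (forall t, upper_half_plane t -> f t = g t) ->
  quasimodular k p f -> quasimodular k p g.
Proof.
by move=> fg [P [wP dP fP]]; exists P; split=> // t t0; rewrite -fg // fP.
Qed.

Lemma quasimodular0 k p : quasimodular k p (fun _ : R[i] => 0).
Proof.
exists 0; split=> [m|m|t _]; rewrite ?msupp0 //.
by rewrite meval0.
Qed.

Lemma quasimodular_linear k p (c : R[i]) f g :
  quasimodular k p f -> quasimodular k p g ->
  quasimodular k p (fun t => c * f t + g t).
Proof.
move=> [P [wP dP fP]] [Q [wQ dQ gQ]]; exists (c *: P + Q); split=> [m|m|t t0].
- move=> /msuppD_le; rewrite mem_cat => /orP[/msuppZ_le|]; [exact: wP|exact: wQ].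
- move=> /msuppD_le; rewrite mem_cat => /orP[/msuppZ_le|]; [exact: dP|exact: dQ].
by rewrite mevalD mevalZ fP // gQ.
Qed.

Lemma quasimodular_scale k p (c : R[i]) f :
  quasimodular k p f -> quasimodular k p (fun t => c * f t).
Proof.
move=> qf; have := quasimodular_linear c qf (quasimodular0 k p).
by apply: quasimodular_ext => t _; rewrite addr0.
Qed.

Lemma quasimodular_sum k p (I : eqType) (s : seq I) (F : I -> R[i] -> R[i]) :
  {in s, forall i, quasimodular k p (F i)} ->
  quasimodular k p (fun t => \sum_(i <- s) F i t).
Proof.
elim: s => [_|i s IH qF].
  by apply: quasimodular_ext (quasimodular0 k p) => t _; rewrite big_nil.
have qi := qF i (mem_head _ _).
have qs : quasimodular k p (fun t => \sum_(i <- s) F i t).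
  by apply: IH => j js; apply: qF; rewrite inE js orbT.
apply: quasimodular_ext (quasimodular_linear 1 qi qs) => t _.
by rewrite big_cons mul1r.
Qed.

Lemma qm_weightE (m : multinom 3) :
  qm_weight m = (2 * m ord0 + 4 * m (lift ord0 ord0) + 6 * m ord_max)%N.
Proof.
have -> : ord_max = lift ord0 (lift ord0 ord0) :> 'I_3 by apply/val_inj.
by rewrite /qm_weight !big_ord_recl big_ord0 /= !(tnth_nth 0%N) /= addn0 addnA.
Qed.

Lemma meval_eisenstein (P : mpoly 3 R[i]) t :
  meval (eisenstein t) P =
  \sum_(m <- msupp P) mcoeff m P * eis_monomial (m ord0) (m (lift ord0 ord0)) (m
    ord_max) t.
Proof.
rewrite mevalE; apply: eq_bigr => m _; congr (_ * _).
have -> : ord_max = lift ord0 (lift ord0 ord0) :> 'I_3 by apply/val_inj.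
by rewrite !big_ord_recl big_ord0 mulr1 mulrA /eisenstein !(tnth_nth 0) /=.
Qed.

Lemma quasimodular_monomial k p i j l : (2 * i + 4 * j + 6 * l)%N = k -> (i <= p)%N ->
  quasimodular k p (@eis_monomial R i j l).
Proof.
move=> ijl ip; pose m : multinom 3 := Multinom [tuple i; j; l].
have [m0 m1 m2] : [/\ m ord0 = i, m (lift ord0 ord0) = j & m ord_max = l].
  by split; rewrite multinomE (tnth_nth 0%N).
exists (mpolyX R[i] m); split=> [m'|m'|t _]; rewrite ?msuppX ?inE.
- by move=> /eqP ->; rewrite qm_weightE m0 m1 m2.
- by move=> /eqP ->; rewrite m0.
by rewrite meval_eisenstein msuppX big_seq1 mcoeffX eqxx mul1r m0 m1 m2.
Qed.

Lemma quasimodular_mul_E4 k p f : quasimodular k p f ->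
  quasimodular (k + 4) p (fun t => E4 t * f t).
Proof.
move=> [P [wP dP fP]].
have := @quasimodular_sum (k + 4) p _ (msupp P) (fun m t => mcoeff m P *
  eis_monomial (m ord0) (m (lift ord0 ord0)).+1 (m ord_max) t).
move=> Q; apply: quasimodular_ext (Q _) => [t t0|m mP].
  rewrite fP // meval_eisenstein mulr_sumr; apply: eq_bigr => m _.
  by rewrite /eis_monomial exprS; ring.
apply/quasimodular_scale/quasimodular_monomial; last exact: dP.
by rewrite -(wP m mP) qm_weightE mulnS; lia.
Qed.

Lemma quasimodular_serre_monomial k p i j l :
  (2 * i + 4 * j + 6 * l)%N = k -> (i <= p)%N ->
  quasimodular (k + 2) p (fun t : R[i] =>
      (i%:R / 12 + j%:R / 3 + l%:R / 2) * eis_monomial i.+1 j l t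
       - i%:R / 12 * eis_monomial i.-1 j.+1 l t
       - j%:R / 3 * eis_monomial i j.-1 l.+1 t
       - l%:R / 2 * eis_monomial i j.+2 l.-1 t
       - ((k%:R - p%:R) / 12)%:C * E2 t * eis_monomial i j l t).
Proof.
move=> <- ip; set k' := (_ + 2)%N.
have Q0 : quasimodular k' p (fun t => (p%:R - i%:R) / 12 * @eis_monomial R i.+1 j l t).
  have [->|ne] := eqVneq i p.
    apply: quasimodular_ext (quasimodular0 k' p) => t _.
    by rewrite subrr !mul0r.
  apply/quasimodular_scale/quasimodular_monomial; first by rewrite /k' mulnS; lia.
  by rewrite ltn_neqAle ne.
(* Exponent 0 is treated apart, here and in the next two terms: the monomial with the truncated
   predecessor then has the wrong weight, but its coefficient is zero. *)
have Q1 : quasimodular k' p (fun t => - (i%:R / 12) * @eis_monomial R i.-1 j.+1 l t).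
  case: i ip @k' {Q0} => [|i] ip k'.
    by apply: quasimodular_ext (quasimodular0 k' p) => t _; rewrite mul0r oppr0 mul0r.
  apply/quasimodular_scale/quasimodular_monomial; last exact: ltnW.
  by rewrite /k' !mulnS /=; lia.
have Q2 : quasimodular k' p (fun t => - (j%:R / 3) * @eis_monomial R i j.-1 l.+1 t).
  case: j @k' {Q0 Q1} => [|j] k'.
    by apply: quasimodular_ext (quasimodular0 k' p) => t _; rewrite mul0r oppr0 mul0r.
  apply/quasimodular_scale/quasimodular_monomial => //.
  by rewrite /k' !mulnS /=; lia.
have Q3 : quasimodular k' p (fun t => - (l%:R / 2) * @eis_monomial R i j.+2 l.-1 t).
  case: l @k' {Q0 Q1 Q2} => [|l] k'.
    by apply: quasimodular_ext (quasimodular0 k' p) => t _; rewrite mul0r oppr0 mul0r.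
  apply/quasimodular_scale/quasimodular_monomial => //.
  by rewrite /k' !mulnS /=; lia.
apply: quasimodular_ext (quasimodular_linear 1 Q0 (quasimodular_linear 1 Q1
  (quasimodular_linear 1 Q2 Q3))) => t _.
have -> : eis_monomial i.+1 j l t = E2 t * eis_monomial i j l t.
  by rewrite /eis_monomial exprS !mulrA.
rewrite rmorphM rmorphB fmorphV !rmorph_nat !natrD.
by field.
Qed.

Lemma serre_quasimodular k p f : quasimodular k p f ->
  quasimodular (k + 2) p (serre (k%:R - p%:R) f).
Proof.
move=> [P [wP dP fP]].
pose F (m : multinom 3) t := mcoeff m P * (
  let i := m ord0 in let j := m (lift ord0 ord0) in let l := m ord_max in
      (i%:R / 12 + j%:R / 3 + l%:R / 2) * eis_monomial i.+1 j l t
       - i%:R / 12 * eis_monomial i.-1 j.+1 l t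
       - j%:R / 3 * eis_monomial i j.-1 l.+1 t
       - l%:R / 2 * eis_monomial i j.+2 l.-1 t
       - ((k%:R - p%:R) / 12)%:C * E2 t * eis_monomial i j l t).
apply: (@quasimodular_ext _ _ (fun t => \sum_(m <- msupp P) F m t)); last first.
  apply: quasimodular_sum => m mP; apply/quasimodular_scale.
  by apply: quasimodular_serre_monomial; [rewrite -qm_weightE; exact: wP|exact: dP].
move=> t t0.
have D : is_derive (t : R[i]^o) (1 : R[i]^o) (f : R[i]^o -> R[i]^o) (\sum_(m <- msupp P)
   (mcoeff m P * (two_pi_i R * (
  let i := m ord0 in let j := m (lift ord0 ord0) in let l := m ord_max in
      (i%:R / 12 + j%:R / 3 + l%:R / 2) * eis_monomial i.+1 j l t
       - i%:R / 12 * eis_monomial i.-1 j.+1 l t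
       - j%:R / 3 * eis_monomial i j.-1 l.+1 t
       - l%:R / 2 * eis_monomial i j.+2 l.-1 t)) : R[i]^o)).
  (* [f] equals the polynomial only on the upper half-plane; as this set is open, the two agree near
     t and share the derivative there. *)
  apply: (@near_eq_is_derive _ _ _ (fun u : R[i]^o => \sum_(m <- msupp P)
     (mcoeff m P * eis_monomial (m ord0) (m (lift ord0 ord0)) (m ord_max) u : R[i]^o))).
  - apply: filterS (upper_half_plane_near t0) => u u0.
    by rewrite fP // meval_eisenstein.
  - apply: is_derive_bigsum => m; apply: is_derive_scale.
    exact: eis_monomial_derive.
rewrite /serre /Dtau derive1E (@derive_val _ _ _ _ _ _ _ D) fP // meval_eisenstein.
rewrite !mulr_sumr -sumrB; apply: eq_bigr => m _; rewrite /F.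
have c0 := two_pi_i_neq0 R.
by field.
Qed.

End Quasimodular.

Theorem theorem11 (R : realType) (k p : nat) (f : R[i] -> R[i])
    (hf : quasimodular k p f) (n : nat) :
  quasimodular (k + 2 * n) p (serre_iter (k%:R - p%:R : R) n f).
Proof.
(* The index (k - p) + 2m is the weight k + 2m minus p, so [serre_quasimodular] applies at every
   stage with the same p. *)
have step m g : quasimodular (k + 2 * m) p g ->
    quasimodular (k + 2 * m.+1) p (serre ((k%:R - p%:R : R) + 2 * m%:R) g).
  move=> /serre_quasimodular; rewrite mulnS addnCA addnC natrD natrM.
  by rewrite addrAC.
(* The recursion reaches back two steps, so the induction carries two consecutive iterates. *)
suff : quasimodular (k + 2 * n) p (serre_iter (k%:R - p%:R : R) n f) /\
       quasimodular (k + 2 * n.+1) p (serre_iter (k%:R - p%:R : R) n.+1 f) by case.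
elim: n => [|n [IH0 IH1]].
  rewrite muln0 addn0; split=> //.
  by have := @step 0 f; rewrite muln0 addn0 mulr0 addr0; apply.
split=> //.
(* E4 raises the weight of the earlier iterate by 4 and leaves its depth bound unchanged, so both
   terms of the recursion have weight k + 2(n + 2). *)
have Q := quasimodular_mul_E4 IH0.
have E : (k + 2 * n + 4 = k + 2 * n.+2)%N by lia.
rewrite E in Q; apply: quasimodular_ext (quasimodular_linear
  (- (n.+1%:R * (n.+1%:R + (k%:R - p%:R) - 1) / 144)%:C) Q (step n.+1 _ IH1)) => t _.
by rewrite /= mulNr addrC mulrA.
Qed.
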